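(* Let $\mathcal{G}$ be a finitely branching stochastic game with countable state space $S$ and objective $\mathtt{B\ddot uchi}(\mathcal{T})$, where $\mathcal{T}\subseteq S$. Then there exist a player $\Box$ MD strategy $\hat\sigma$ and a player $\Diamond$ MD strategy $\hat\pi$ such that for all states $s\in S$: \[ \text{for all player } \Diamond \text{ strategies } \pi:\ \mathcal{P}_{\mathcal{G},s,\hat\sigma,\pi}(\mathtt{B\ddot uchi}(\mathcal{T})) = 1, \] or \[ \text{for all player } \Box \text{ strategies } \sigma:\ \mathcal{P}_{\mathcal{G},s,\sigma,\hat\pi}(\mathtt{B\ddot uchi}(\mathcal{T})) < 1. \] Hence finitely branching games with almost-sure Büchi objectives are strongly MD-determined, i.e., for every state $s$, either player $\Box$ has an MD strategy $\sigma$ with $\mathcal{P}_{\mathcal{G},s,\sigma,\pi}(\mathtt{B\ddot uchi}(\mathcal{T})) = 1$ for all $\pi$, or player $\Diamond$ has an MD strategy $\pi$ with $\mathcal{P}_{\mathcal{G},s,\sigma,\pi}(\mathtt{B\ddot uchi}(\mathcal{T})) < 1$ for all $\sigma$.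
   Context: A (2-player turn-based stochastic) game is $\mathcal{G} = (S,(S_\Box,S_\Diamond,S_\bigcirc),\longrightarrow,P)$, where $S$ is a countable set of states partitioned into the states $S_\Box$ of player $\Box$ (maximizer), the states $S_\Diamond$ of player $\Diamond$ (minimizer) and the random states $S_\bigcirc$; $\longrightarrow\, \subseteq S\times S$ is the transition relation, such that every state has at least one successor ($s'$ is a successor of $s$ if $s \longrightarrow s'$); and $P$ assigns to each $s \in S_\bigcirc$ a probability distribution over its successors. The game is finitely branching if each state has only finitely many successors. A strategy of player $\Box$ is a function $\sigma$ assigning to each finite sequence $ws \in S^*S_\Box$ a probability distribution over the successors of $s$; strategies $\pi$ of player $\Diamond$ are defined analogously on $S^*S_\Diamond$. (Strategies may be history-dependent and randomized.) A strategy is MD (memoryless deterministic) if it chooses with probability 1 a single successor that depends only on the current state $s$. Given an initial state $s_0$ and strategies $\sigma,\pi$, $\mathcal{P}_{\mathcal{G},s_0,\sigma,\pi}$ is the unique probability measure on the Borel $\sigma$-algebra of $s_0S^\omega$ (generated by cylinder sets) with $\mathcal{P}_{\mathcal{G},s_0,\sigma,\pi}(s_0 s_1\cdots s_n S^\omega) = \prod_{i=0}^{n-1} \tau(s_0\cdots s_i)(s_{i+1})$, where $\tau(ws)$ equals $\sigma(ws)$, $\pi(ws)$ or $P(s)$ according to whether $s \in S_\Box$, $S_\Diamond$ or $S_\bigcirc$. For $\mathcal{E} \subseteq S^\omega$, $\mathcal{P}_{\mathcal{G},s_0,\sigma,\pi}(\mathcal{E})$ means $\mathcal{P}_{\mathcal{G},s_0,\sigma,\pi}(\mathcal{E}\cap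 s_0S^\omega)$. $\mathtt{B\ddot uchi}(\mathcal{T}) = \{s_0s_1\cdots \in S^\omega \mid \forall i\,\exists j \ge i.\ s_j \in \mathcal{T}\}$. *)

(* Defs.v *)
From HB Require Import structures.
From mathcomp Require Import all_boot all_order all_algebra.
From mathcomp Require Import all_classical all_reals all_analysis.
Set Implicit Arguments.
Unset Strict Implicit.
Unset Printing Implicit Defensive.
Import Order.TTheory GRing.Theory Num.Theory.
Local Open Scope classical_set_scope.
Local Open Scope ring_scope.

Record distr (R : realType) (S : countType) := Distr {
  mass :> S -> R ;
  mass_ge0 : forall s, 0 <= mass s ;
  mass_sum1 : (\esum_(s in [set: S]) (mass s)%:E = 1)%E }.

Definition supported (R : realType) (S : countType) (d : distr R S)
  (A : set S) := forall s, ~ A s -> d s = 0.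

(* The pointed type S^omega; the base state s0 is only used as the default
   element that MathComp-Analysis requires of a measurable type. *)
Definition run (S : countType) (s0 : S) := nat -> S.

HB.instance Definition _ (S : countType) (s0 : S) :=
  Choice.on (run s0).
HB.instance Definition _ (S : countType) (s0 : S) :=
  isPointed.Build (run s0) (fun=> s0).

Definition cylinder (S : countType) (w : seq S) : set (nat -> S) :=
  [set r | mkseq r (size w) = w].

Definition cylinders (S : countType) (s0 : S) : set (set (run s0)) :=
  range (@cylinder S).
Arguments cylinders {S} s0.

Notation runs s0 := (g_sigma_algebraType (cylinders s0)).

(* Ionescu-Tulcea for a countable alphabet: k w is the law of the letter that
   follows w.  The measure is the Caratheodory extension of cylinder weights. *)
Section infinite_words.
Context (R : realType) (S : countType) (s0 : S) (k : seq S -> distr R S).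
Local Open Scope ereal_scope.

Lemma esumZl (T : choiceType) (D : set T) (c : R) (a : T -> \bar R) :
  (0 <= c)%R -> (forall i, 0 <= a i) ->
  \esum_(i in D) (c%:E * a i) = c%:E * \esum_(i in D) a i.
Proof.
move=> c0 a0.
have le (b : R) (f : T -> \bar R) : (0 <= b)%R -> (forall i, 0 <= f i) ->
    \esum_(i in D) (b%:E * f i) <= b%:E * \esum_(i in D) f i.
  move=> b0 f0; apply: ge_ereal_sup => _ [X [fX XD] <-].
  rewrite -ge0_mule_fsumr//; apply: lee_wpmul2l; first by rewrite lee_fin.
  by apply: ereal_sup_ubound; exists X.
apply/eqP; rewrite eq_le le//=.
have [->|cn0] := eqVneq c 0%R.
  by rewrite mul0e; apply: esum_ge0 => i _; rewrite mul0e.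
have cp : (0 < c)%R by rewrite lt_neqAle eq_sym cn0.
have := le c^-1%R (fun i => c%:E * a i); rewrite invr_ge0 => /(_ c0).
have ca i : 0 <= c%:E * a i by rewrite mule_ge0// lee_fin.
move=> /(_ ca).
under eq_esum do rewrite muleA -EFinM mulVf// mul1e.
move=> /(lee_wpmul2l (_ : 0 <= c%:E)); rewrite lee_fin => /(_ c0).
by rewrite muleA -EFinM divff// mul1e.
Qed.

Lemma esum_subset (T : choiceType) (A B : set T) (a : T -> \bar R) :
  (forall i, 0 <= a i) -> A `<=` B ->
  \esum_(i in A) a i <= \esum_(i in B) a i.
Proof.
move=> a0 AB; apply: ge_ereal_sup => _ [X [fX XA] <-].
by apply: ereal_sup_ubound; exists X => //; split => //; exact: subset_trans AB.
Qed.

Lemma esum_bigcup_choice (T I : choiceType) (K : set I) (J : I -> set T)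
  (a : T -> \bar R) : trivIset setT J -> (forall x, 0 <= a x) ->
  \esum_(i in \bigcup_(k in K) (J k)) a i =
  \esum_(i in K) \esum_(j in J i) a j.
Proof.
move=> tJ a0; rewrite esum_esum//; apply: reindex_esum => //; split.
- by move=> [/= i j] [Ki Jij]; exists i.
- move=> [/= i1 j1] [/= i2 j2]; rewrite ?inE/=.
  move=> [K1 J1] [K2 J2] j12; congr (_, _) => //.
  by apply: (@tJ i1 i2) => //; exists j1; split=> //; rewrite j12.
- by move=> j [i Ki Jij]/=; exists (i, j).
Qed.

Definition weight (w : seq S) : R :=
  \prod_(i < size w) k (take i w) (nth s0 w i).

Lemma weight_nil : weight [::] = 1%R. Proof. by rewrite /weight big_ord0. Qed.

Lemma weight_ge0 w : 0 <= (weight w)%:E.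
Proof. by rewrite lee_fin; apply: prodr_ge0 => i _; exact: mass_ge0. Qed.

Lemma weight_rcons w s : weight (rcons w s) = (weight w * k w s)%R.
Proof.
rewrite /weight size_rcons big_ord_recr/= nth_rcons ltnn eqxx.
rewrite -{3}cats1 take_size_cat//; congr *%R; apply: eq_bigr => i _.
by rewrite nth_rcons ltn_ord -cats1 takel_cat// ltnW.
Qed.

Lemma esum_weight_rcons w :
  \esum_(s in [set: S]) (weight (rcons w s))%:E = (weight w)%:E.
Proof.
under eq_esum do rewrite weight_rcons EFinM.
rewrite esumZl ?mass_sum1 ?mule1// => [|i]; last by rewrite lee_fin mass_ge0.
by rewrite -lee_fin weight_ge0.
Qed.

Lemma cylinder_prefix (v c : seq S) :
  prefix v c -> cylinder c `<=` cylinder v.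
Proof.
move=> /prefixP[t ->] r; rewrite /cylinder/= size_cat => /(congr1 (take (size v))).
by rewrite /mkseq iotaD map_cat !take_size_cat// size_map size_iota.
Qed.

Lemma cylinder_comp (v c : seq S) r : (size v <= size c)%N ->
  cylinder c r -> cylinder v r -> prefix v c.
Proof.
rewrite /cylinder/= => vc cE vE; rewrite prefixE -{1}cE -[X in _ == X]vE.
by rewrite -{1}(subnKC vc) /mkseq iotaD map_cat take_size_cat// size_map size_iota.
Qed.

Lemma cylinder_nil : @cylinder S [::] = setT.
Proof. by apply/seteqP; split. Qed.

Lemma prefix_rconsI (v c : seq S) s : prefix (rcons v s) c -> prefix v c.
Proof. by move=> /prefixP[t ->]; rewrite cat_rcons prefix_prefix. Qed.

Lemma prefix_neq (v c : seq S) : prefix v c -> v != c ->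
  exists s, prefix (rcons v s) c.
Proof.
move=> /prefixP[[|s t] ->]; first by rewrite cats0 eqxx.
by move=> _; exists s; rewrite -cat_rcons prefix_prefix.
Qed.

Lemma prefix_rcons_inj (v c : seq S) s t :
  prefix (rcons v s) c -> prefix (rcons v t) c -> s = t.
Proof.
move=> /prefixP[x ->]; rewrite prefixE !size_rcons.
by rewrite take_size_cat ?size_rcons// => /eqP/rcons_inj[].
Qed.

Let below (C : set (seq S)) v := \esum_(c in C `&` [set c | prefix v c]) (weight c)%:E.

Lemma below_rcons C v : ~ C v ->
  below C v = \esum_(s in [set: S]) below C (rcons v s).
Proof.
move=> Cv; rewrite /below.
rewrite -(@esum_bigcup_choice _ _ setT
  (fun s => C `&` [set c | prefix (rcons v s) c])); last 2 first.
  - move=> s t _ _ [c [[_ /= ps] [_ /= pt]]]; exact: prefix_rcons_inj ps pt.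
  - by move=> c; exact: weight_ge0.
congr esum; apply/seteqP; split=> c /=.
  move=> [Cc pc]; have [||s ps] := @prefix_neq v c => //.
    by apply/eqP => vc; apply: Cv; rewrite vc.
  by exists s.
by move=> [s _ [Cc /prefix_rconsI]].
Qed.

Definition wcover (C : set (seq S)) : set (nat -> S) :=
  \bigcup_(c in C) cylinder c.

Lemma weight_le_cover w C : cylinder w `<=` wcover C ->
  (weight w)%:E <= \esum_(c in C) (weight c)%:E.
Proof.
move=> wC; rewrite leNgt; apply/negP => ltw.
pose bad v := prefix w v /\ below C v < (weight v)%:E.
have badC v : bad v -> ~ C v.
  move=> [_ + Cv]; rewrite ltNge => /negP; apply.
  rewrite /below -(@esum_set1 R _ v (fun c => (weight c)%:E)) ?weight_ge0//.
  apply: esum_subset => [c|c ->]; first exact: weight_ge0.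
  by split => //=; exact: prefix_refl.
have bad_next v : bad v -> exists s, bad (rcons v s).
  move=> bv; have [pv vlt] := bv; apply: contrapT => /forallNP nb.
  move: vlt; rewrite ltNge => /negP; apply.
  rewrite below_rcons; last exact: badC.
  rewrite -esum_weight_rcons; apply: le_esum => s _.
  rewrite leNgt; apply/negP => lts; apply: (nb s); split => //.
  by move/prefixP : pv => [t ->]; rewrite rcons_cat prefix_prefix.
have [g gP] : {g : {v | bad v} -> S & forall v, bad (rcons (sval v) (g v))}.
  apply: (@choice _ _ (fun v s => bad (rcons (sval v) s))) => -[v bv].
  exact: bad_next.
have bw : bad w.
  split; first exact: prefix_refl.
  apply: le_lt_trans ltw; apply: esum_subset => [c|c []//]; exact: weight_ge0.
pose nx (v : {v | bad v}) : {v | bad v} := exist _ _ (gP v).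
pose V n := sval (iter n nx (exist _ w bw)).
have VS n : V n.+1 = rcons (V n) (g (iter n nx (exist _ w bw))) by [].
have szV n : size (V n) = (size w + n)%N.
  by elim: n => [|n ih]; rewrite ?addn0// VS size_rcons ih addnS.
have Vmono m n : prefix (V m) (V (m + n)%N).
  elim: n => [|n ih]; first by rewrite addn0 prefix_refl.
  by rewrite addnS VS; move/prefixP : ih => [t ->]; rewrite rcons_cat prefix_prefix.
have Vbad n : bad (V n) by rewrite /V; case: (iter _ _ _).
pose r i := nth s0 (V i.+1) i.
have rV n : cylinder (V n) r.
  rewrite /cylinder/=; apply: (@eq_from_nth _ s0); first by rewrite size_mkseq.
  move=> i; rewrite size_mkseq => iV; rewrite nth_mkseq// /r.
  have i1 : (i < size (V i.+1))%N by rewrite szV addnS ltnS leq_addl.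
  have /prefixP[t Et] := Vmono n i.+1.
  have /prefixP[u Eu] := Vmono i.+1 n.
  have := erefl (nth s0 (V (n + i.+1)%N) i).
  by rewrite {1}Et [in RHS]addnC Eu !nth_cat iV i1 => ->.
have [c Cc cr] : wcover C r by apply: wC; exact: (rV 0%N).
have Vc n : (size c <= size (V n))%N -> False.
  move=> cV; have pc := cylinder_comp cV (rV n) cr.
  have [wc|cw] := leqP (size w) (size c).
    pose m := (size c - size w)%N.
    have sm : size (V m) = size c by rewrite szV subnKC.
    apply: (badC _ (Vbad m)); suff -> : V m = c by [].
    by have := rV m; have := cr; rewrite /cylinder/= sm => -> .
  have pw : prefix c w by apply: (cylinder_comp (ltnW cw) (rV 0%N)).
  move: ltw; rewrite ltNge => /negP; apply.
  apply: (@le_trans _ _ (weight c)%:E); last first.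
    rewrite -(@esum_set1 R _ c (fun c => (weight c)%:E)) ?weight_ge0//.
    by apply: esum_subset => [x|x ->//]; exact: weight_ge0.
  move/prefixP : pw => [t ->]; elim/last_ind: t => [|t x ih].
    by rewrite cats0.
  rewrite -rcons_cat (le_trans _ ih)// -[leRHS]esum_weight_rcons.
  rewrite -(@esum_set1 R _ x (fun x => (weight (rcons (c ++ t) x))%:E)) ?weight_ge0//.
  by apply: esum_subset => [y|y//]; exact: weight_ge0.
apply: (Vc (size c)); rewrite szV; exact: leq_addl.
Qed.

Definition outer (E : set (nat -> S)) : \bar R :=
  ereal_inf [set \esum_(c in C) (weight c)%:E | C in [set C | E `<=` wcover C]].

Lemma outer_cylinder w : outer (cylinder w) = (weight w)%:E.
Proof.
apply/eqP; rewrite eq_le; apply/andP; split.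
  apply: ereal_inf_lbound; exists [set w]; first by rewrite /= /wcover bigcup_set1.
  by rewrite esum_set1// weight_ge0.
by apply: le_ereal_inf_tmp => _ [C wC <-]; exact: weight_le_cover.
Qed.

Lemma outer0 : outer set0 = 0.
Proof.
apply/eqP; rewrite eq_le; apply/andP; split.
  by apply: ereal_inf_lbound; exists set0; [exact: sub0set|rewrite esum_set0].
by apply: le_ereal_inf_tmp => _ [C wC <-]; apply: esum_ge0 => c _; exact: weight_ge0.
Qed.

Lemma outer_ge0 E : 0 <= outer E.
Proof.
by apply: le_ereal_inf_tmp => _ [C wC <-]; apply: esum_ge0 => c _; exact: weight_ge0.
Qed.

Lemma le_outer : {homo outer : A B / A `<=` B >-> A <= B}.
Proof.
move=> A B AB; apply: le_ereal_inf_tmp => _ [C BC <-]; apply: ereal_inf_lbound.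
by exists C => //; exact: subset_trans BC.
Qed.

Lemma outer_sigma_subadditive : sigma_subadditive outer.
Proof.
move=> A; have [[i ioo]|] := pselect (exists i, outer (A i) = +oo).
  rewrite (eseries_pinfty _ _ ioo) ?leey// => n _.
  by rewrite -ltNye (lt_le_trans _ (outer_ge0 _)).
rewrite -forallNE => Aoo.
apply/lee_addgt0Pr => e e0.
rewrite (le_trans _ (epsilon_trick _ _ _))//; [|by move=> n; exact: outer_ge0|exact: ltW].
pose P n (C : set (seq S)) := A n `<=` wcover C /\
  \esum_(c in C) (weight c)%:E <= outer (A n) + (e / (2 ^ n.+1)%:R)%:E.
have [G PG] : {G : (set (seq S))^nat & forall n, P n (G n)}.
  apply: (@choice _ _ P) => n.
  have fA : outer (A n) \is a fin_num.
    by rewrite ge0_fin_numE ?outer_ge0// ltey; apply/eqP; exact: Aoo.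
  have en : (0 < e / (2 ^ n.+1)%:R)%R by rewrite divr_gt0.
  have [_ [C AC <-] ltC] := lb_ereal_inf_adherent en fA.
  by exists C; split => //; exact: ltW.
apply: (@le_trans _ _ (\esum_(c in \bigcup_n G n) (weight c)%:E)).
  apply: ereal_inf_lbound; exists (\bigcup_n G n) => // r [n _ Anr].
  by have [c Gc cr] := (PG n).1 _ Anr; exists c => //; exists n.
rewrite seqDU_bigcup_eq nneseries_sum_bigcup//; last first.
  by move=> c; exact: weight_ge0.
apply: lee_nneseries => n _.
  by move=> _; apply: esum_ge0 => c _; exact: weight_ge0.
apply: le_trans (PG n).2; apply: esum_subset => [c|]; first exact: weight_ge0.
exact: subset_seqDU.
Qed.

HB.instance Definition _ := isOuterMeasure.Build R (run s0) outer
  outer0 outer_ge0 le_outer outer_sigma_subadditive.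

Lemma outer_bigcup (C : set (seq S)) (E : seq S -> set (nat -> S)) :
  outer (\bigcup_(c in C) E c) <= \esum_(c in C) outer (E c).
Proof.
pose F n := if pickle_inv n is Some c then (if c \in C then E c else set0) else set0.
have -> : \bigcup_(c in C) E c = \bigcup_n F n.
  apply/seteqP; split=> r.
    by move=> [c Cc Ecr]; exists (pickle c) => //; rewrite /F pickleK_inv mem_set.
  move=> [n _]; rewrite /F; case: (pickle_inv n) => // c.
  by case: ifPn => // /set_mem Cc ?; exists c.
apply: le_trans (outer_sigma_subadditive _) _.
rewrite nneseries_esumT; last by move=> n; exact: outer_ge0.
rewrite (_ : esum _ _ = \esum_(n in pickle @` C) outer (F n)); last first.
  rewrite [RHS]esum_mkcond; apply: eq_esum => n _; case: ifPn => // nC.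
  rewrite /F; case E1 : (pickle_inv n) => [c|]; last exact: outer0.
  case: ifPn => [/set_mem Cc|]; last by rewrite outer0.
  exfalso; move/negP : nC; apply; apply/mem_set; exists c => //.
  by have := @pickle_invK (seq S) n; rewrite E1.
rewrite esum_image; last by move=> x y _ _; exact: (pcan_inj pickleK).
by apply: le_esum => c Cc; rewrite /F pickleK_inv mem_set.
Qed.

Lemma esum_weight_level c n :
  \esum_(v in [set v | prefix c v /\ size v = (size c + n)%N]) (weight v)%:E
  <= (weight c)%:E.
Proof.
elim: n => [|n ih].
  rewrite addn0 -(@esum_set1 R _ c (fun c => (weight c)%:E)) ?weight_ge0//.
  apply: esum_subset => [v|v /= [/prefixP[t ->]]]; first exact: weight_ge0.
  by rewrite size_cat -[RHS]addn0 => /addnI/size0nil ->; rewrite cats0.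
apply: le_trans ih.
pose L := [set v | prefix c v /\ size v = (size c + n)%N].
have -> : [set v | prefix c v /\ size v = (size c + n.+1)%N] =
    \bigcup_(v in L) (rcons v @` setT).
  apply/seteqP; split=> v /=.
    move=> [/prefixP[t ->]]; elim/last_ind: t => [|t x _].
      by rewrite cats0 => /eqP; rewrite -{1}(addn0 (size c)) eqn_add2l.
    rewrite -rcons_cat size_rcons addnS => -[sz]; exists (c ++ t); last by exists x.
    by split => //; exact: prefix_prefix.
  move=> [u [pu su] [x _ <-]]; rewrite size_rcons su addnS; split => //.
  by move/prefixP : pu => [t ->]; rewrite rcons_cat prefix_prefix.
rewrite esum_bigcup_choice; last 2 first.
  - by move=> u v _ _ [x [[a _ <-] [b _]]] /rcons_inj[].
  - by move=> v; exact: weight_ge0.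
apply: le_esum => v _; rewrite esum_image ?esum_weight_rcons//.
by move=> x y _ _ /rcons_inj[].
Qed.

Lemma caratheodory_cylinder w :
  (outer : set (run s0) -> \bar R).-caratheodory (cylinder w).
Proof.
apply: le_caratheodory_measurable => X; set A := cylinder w.
apply: le_ereal_inf_tmp => _ [C XC <-].
apply: (@le_trans _ _ (\esum_(c in C) (outer (cylinder c `&` A) +
                                       outer (cylinder c `&` ~` A)))).
  rewrite esumD; do ?by move=> *; exact: outer_ge0.
  apply: leeD; apply: le_trans (outer_bigcup _ _); apply: le_outer => r [Xr Ar];
    by have [c Cc cr] := XC _ Xr; exists c.
apply: le_esum => c _.
have [wc|cw] := leqP (size w) (size c).
  rewrite -[leRHS]outer_cylinder.
  have [pwc|npwc] := boolP (prefix w c).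
    have cA := cylinder_prefix pwc.
    have -> : cylinder c `&` ~` A = set0.
      by apply/seteqP; split=> // r [/cA].
    by rewrite (setIidl cA) outer0 adde0.
  have -> : cylinder c `&` A = set0.
    apply/seteqP; split=> // r [cr wr]; move/negP : npwc; apply.
    exact: cylinder_comp wr.
  by rewrite outer0 add0e; apply: le_outer => r [].
have [pcw|npcw] := boolP (prefix c w); last first.
  have -> : cylinder c `&` A = set0.
    apply/seteqP; split=> // r [cr wr]; move/negP : npcw; apply.
    exact: cylinder_comp (ltnW cw) wr cr.
  by rewrite outer0 add0e -[leRHS]outer_cylinder; apply: le_outer => r [].
set L := [set v | prefix c v /\ size v = (size c + (size w - size c))%N].
have Lw : L w by split => //; rewrite subnKC// ltnW.
apply: le_trans (esum_weight_level c (size w - size c)%N).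
rewrite -/L (esumID [set w]) => [|v _]; last exact: weight_ge0.
have -> : L `&` [set w] = [set w].
  by apply/seteqP; split=> [v []//|v ->].
rewrite esum_set1 ?weight_ge0//; apply: leeD.
  by rewrite -outer_cylinder; apply: le_outer => r [].
apply: ereal_inf_lbound; exists (L `&` ~` [set w]) => // r [cr nwr].
have sz : size (mkseq r (size w)) = size w by rewrite size_mkseq.
have vr : cylinder (mkseq r (size w)) r by rewrite /cylinder/= sz.
exists (mkseq r (size w)) => //; split.
  split; last by rewrite sz subnKC// ltnW.
  by apply: (cylinder_comp _ vr cr); rewrite sz ltnW.
by move=> /= e; apply: nwr; rewrite /A -e.
Qed.

Definition word_measure : set (runs s0) -> \bar R := outer.

Let word_measure0 : word_measure set0 = 0. Proof. exact: outer0. Qed.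

Let word_measure_ge0 A : 0 <= word_measure A. Proof. exact: outer_ge0. Qed.

Let word_measure_sigma_additive : semi_sigma_additive word_measure.
Proof.
have sub : (@measurable _ (runs s0)) `<=`
    (outer : set (run s0) -> \bar R).-caratheodory.
  have := @sigma_algebra_measurable _
    (caratheodory_type (outer : set (run s0) -> \bar R)).
  move=> sa; apply: smallest_sub => // _ [w _ <-].
  exact: caratheodory_cylinder.
move=> F mF tF mUF.
apply: (@caratheodory_measure_sigma_additive R (run s0) outer) => //.
  by move=> i; exact: sub (mF i).
exact: sub mUF.
Qed.

HB.instance Definition _ := isMeasure.Build _ _ _ word_measure
  word_measure0 word_measure_ge0 word_measure_sigma_additive.

Let word_measure1 : word_measure setT = 1.
Proof.
by rewrite -[X in word_measure X]cylinder_nil /word_measure outer_cylinder weight_nil.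
Qed.

HB.instance Definition _ :=
  Measure_isProbability.Build _ _ _ word_measure word_measure1.

Lemma word_measureE w : word_measure (cylinder w) = (weight w)%:E.
Proof. exact: outer_cylinder. Qed.

End infinite_words.
Arguments word_measure {R S} s0 k.

Section cylinder_uniqueness.
Context (R : realType) (S : countType) (s0 : S).

Lemma measurable_cylinder (w : seq S) :
  measurable (cylinder w : set (runs s0)).
Proof. by apply: sub_sigma_algebra; exists w. Qed.

Lemma cylinder_unique (P Q : probability (runs s0) R) :
  (forall w, P (cylinder w) = Q (cylinder w)) ->
  forall E, measurable E -> P E = Q E.
Proof.
move=> PQ E mE; pose G : set (set (runs s0)) := cylinders s0 `|` [set set0].
apply: (measure_unique G (fun=> setT)) => //.
- apply/seteqP; split.
    by apply: sub_smallest2r; [exact: smallest_sigma_algebra|exact: subsetUl].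
  apply: smallest_sub; first exact: sigma_algebra_measurable.
  by move=> _ [[w _ <-]|->]; [exact: measurable_cylinder|exact: measurable0].
- have aux v c : (size v <= size c)%N -> G (cylinder v `&` cylinder c).
    move=> vc; have [/cylinder_prefix cv|np] := boolP (prefix v c).
      by left; exists c => //; rewrite setIidr.
    right; apply/seteqP; split=> // r [vr cr]; move/negP : np; apply.
    exact: cylinder_comp cr vr.
  move=> _ _ [[v _ <-]|->] [[c _ <-]|->]; rewrite ?set0I ?setI0; do ?by right.
  by have [/aux//|/ltnW/aux] := leqP (size v) (size c); rewrite setIC.
- by move=> _; left; exists [::] => //; exact: cylinder_nil.
- by rewrite bigcup_const//; exists 0%N.
- by move=> B [[w _ <-]|->]; [exact: PQ|rewrite !measure0].
- by move=> _; change (P setT < +oo)%E; rewrite probability_setT ltry.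
Qed.

End cylinder_uniqueness.

Section dirac_distr.
Context (R : realType) (S : countType) (s : S).

Let dirac_mass (t : S) : R := (t == s)%:R.

Let dirac_mass_ge0 t : 0 <= dirac_mass t. Proof. exact: ler0n. Qed.

Let dirac_mass_sum1 : (\esum_(t in [set: S]) (dirac_mass t)%:E = 1)%E.
Proof.
transitivity (\esum_(t in [set s]) (1 : \bar R))%E; last by rewrite esum_set1.
rewrite [RHS]esum_mkcond; apply: eq_esum => t _; rewrite /dirac_mass.
case: eqVneq => [->|ts]; first by rewrite mem_set.
by rewrite memNset//=; exact/eqP.
Qed.

Definition dirac_distr : distr R S := Distr dirac_mass_ge0 dirac_mass_sum1.

End dirac_distr.

Inductive player := Box | Diamond.

(* owner s = None means that s is a random state; rand s is only relevant for
   random s, just as a strategy is only relevant at the states of its player. *)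
Record game (R : realType) (S : countType) := Game {
  owner : S -> option player ;
  edge : S -> S -> Prop ;
  edge_total : forall s, exists s', edge s s' ;
  rand : S -> distr R S ;
  rand_supported : forall s, owner s = None -> supported (rand s) (edge s) }.

Definition finitely_branching (R : realType) (S : countType) (G : game R S) :=
  forall s, finite_set [set s' | edge G s s'].

(* act w s is the distribution chosen after the history ws. *)
Record strategy (R : realType) (S : countType) (G : game R S) (p : player) :=
  Strategy {
    act :> seq S -> S -> distr R S ;
    act_supported : forall w s, owner G s = Some p ->
      supported (act w s) (edge G s) }.

Definition is_MD (R : realType) (S : countType) (G : game R S) (p : player)
  (sigma : strategy G p) :=
  exists f : S -> S, forall w s, owner G s = Some p -> sigma w s (f s) = 1.

Section play.
Context (R : realType) (S : countType) (G : game R S).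
Context (sigma : strategy G Box) (pi : strategy G Diamond).

Definition tau (w : seq S) (s : S) : distr R S :=
  match owner G s with
  | Some Box => sigma w s
  | Some Diamond => pi w s
  | None => rand G s
  end.

Definition tau_word (s0 : S) (v : seq S) : distr R S :=
  if v is s :: w then tau (belast s w) (last s w) else dirac_distr R s0.

(* A probability on the whole of S^omega that is concentrated on s0 S^omega
   (play_lawE with w = [::]), so that intersecting an event with s0 S^omega
   does not change its probability.  play_lawE and play_law_unique say that it
   is the only one with the prescribed values on the cylinders s0 w S^omega. *)
Definition play_law (s0 : S) : probability (runs s0) R :=
  word_measure s0 (tau_word s0).

Definition path_weight (s0 : S) (w : seq S) : R :=
  \prod_(i < size w)
    tau (take i (s0 :: w)) (nth s0 (s0 :: w) i) (nth s0 w i).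

Lemma play_lawE (s0 : S) (w : seq S) :
  play_law s0 (cylinder (s0 :: w)) = (path_weight s0 w)%:E.
Proof.
rewrite [LHS]word_measureE; congr EFin.
rewrite /weight /= big_ord_recl/= eqxx mul1r; apply: eq_bigr => i _ /=.
have aux s v j : (j < size v)%N ->
    belast s (take j v) = take j (s :: v) /\ last s (take j v) = nth s0 (s :: v) j.
  by elim: v s j => [//|x v ih] s [//|j] /= /(ih x)[-> ->].
by have [-> ->] := aux s0 _ _ (ltn_ord i).
Qed.

Lemma play_law_unique (s0 : S) (P : probability (runs s0) R) :
  (forall w, P (cylinder (s0 :: w)) = (path_weight s0 w)%:E) ->
  forall E, measurable E -> P E = play_law s0 E.
Proof.
move=> PE.
have total (Q : probability (runs s0) R) :
    Q (cylinder [::]) = 1%E.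
  by rewrite cylinder_nil; exact: probability_setT.
have off (Q : probability (runs s0) R) :
    (forall w, Q (cylinder (s0 :: w)) = (path_weight s0 w)%:E) ->
    forall s w, s != s0 -> Q (cylinder (s :: w)) = 0%E.
  move=> QE s w ss0; apply/eqP; rewrite eq_le measure_ge0 andbT.
  have m0 := @measurable_cylinder S s0 [:: s0].
  have <- : Q (~` cylinder [:: s0]) = 0%E.
    rewrite probability_setC// QE /path_weight big_ord0.
    by rewrite -EFinB subrr.
  apply: le_measure; rewrite ?inE//; first exact: measurable_cylinder.
    exact: measurableC.
  by move=> r; rewrite /cylinder/= => -[r0 _] [r0']; move: ss0; rewrite -r0 r0' eqxx.
apply: cylinder_unique => -[|s w]; first by rewrite !total.
have [->|ss0] := eqVneq s s0; first by rewrite PE play_lawE.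
by rewrite !off//; exact: play_lawE.
Qed.

Definition prob (s0 : S) (E : set (nat -> S)) : \bar R := play_law s0 E.

End play.

Definition buchi (S : Type) (T : set S) : set (nat -> S) :=
  [set r | forall i, exists2 j, (i <= j)%N & T (r j)].

Lemma measurable_buchi (S : countType) (s0 : S) (T : set S) :
  measurable (buchi T : set (runs s0)).
Proof.
pose visit j : set (runs s0) := [set r | T (r j)].
have mvisit j : measurable (visit j).
  rewrite (_ : visit j = \bigcup_(w : seq S)
      if (size w == j.+1) && (nth s0 w j \in T) then cylinder w else set0).
    apply: countable_bigcupT_measurable => // w.
    by case: ifP => _; [exact: measurable_cylinder|exact: measurable0].
  apply/seteqP; split=> r /=.
    move=> Tr; pose w := mkseq r j.+1; exists w => //.
    have sw : size w = j.+1 by exact: size_mkseq.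
    rewrite sw eqxx (_ : nth s0 w j = r j) ?nth_mkseq// mem_set//.
    by rewrite /cylinder /mkset sw.
  move=> [w _]; case: ifP => // /andP[/eqP sw /set_mem Tw].
  by rewrite /cylinder/= /visit/= => rw; move: Tw; rewrite -rw nth_mkseq// sw.
rewrite (_ : buchi T = \bigcap_i \bigcup_(j in [set j | (i <= j)%N]) visit j).
  by apply: bigcapT_measurable => i; apply: bigcup_measurable => j _.
apply/seteqP; split=> [r br i _|r br i].
  by have [j ij Tj] := br i; exists j.
by have [j ij Tj] := br i I; exists j.
Qed.

Definition almost_surely_strongly_MD_determined (R : realType) (S : countType)
  (G : game R S) (E : set (nat -> S)) :=
  forall s : S,
    (exists2 sigma : strategy G Box, is_MD sigma &
      forall pi : strategy G Diamond, prob sigma pi s E = 1%E) \/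
    (exists2 pi : strategy G Diamond, is_MD pi &
      forall sigma : strategy G Box, (prob sigma pi s E < 1)%E).

(* Main.v *)
(* Let [M] be a maximal partial memoryless Diamond strategy that prevents Box
   from winning almost surely from any state of its domain [L].  Outside [L],
   the value of reaching T while avoiding L is 1 everywhere: otherwise [M] could
   be extended, on the states of value < 1, by moves that minimise the value
   (finite branching provides them).  It remains to find one memoryless Box
   strategy on the complement of [L], following Ornstein.  If every state outside
   [L] has value at least p > 0, then retrying after each failure shows that
   every such state has value 1.  Hence one may fix, for one state after the
   other, the moves of an optimal strategy of a discounted game wherever the
   discounted value is at least 1/2: all values stay bounded away from 0, hence
   equal to 1, and the fixed moves alone guarantee probability 1/4 from the
   given state.  In the limit all moves are fixed, every value is at least 1/4,
   hence equal to 1, so that T is almost surely visited again and again. *)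
Require Import Defs.
From mathcomp Require Import all_boot all_order all_algebra.
From mathcomp Require Import all_classical all_reals all_analysis.
From mathcomp Require Import ring lra.
Set Implicit Arguments.
Unset Strict Implicit.
Unset Printing Implicit Defensive.
Import Order.TTheory GRing.Theory Num.Theory.
Local Open Scope classical_set_scope.
Local Open Scope ring_scope.

(** * Elementary estimates: powers, finite lists, finitely supported sums *)

Lemma expr_small (R : realType) (q e : R) :
  0 <= q -> q < 1 -> 0 < e -> exists n, q ^+ n < e.
Proof.
move=> q0 q1 e0; have : `|q| < 1 by rewrite ger0_norm.
move=> /cvg_expr /cvgr0_norm_lt /(_ e e0) [n _ /(_ n (leqnn n))] /=.
by rewrite ger0_norm ?exprn_ge0//; exists n.
Qed.

(** Bernoulli's inequality for [(1 - x) ^+ n]. In [x], the denominator [n.+1] avoids a division by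
    0, and the minimum with 1 keeps [1 - x] nonnegative. *)
Lemma expr_close_to1 (R : realType) (n : nat) (e : R) : 0 < e ->
  exists q : R, [/\ 0 <= q, q < 1 & 1 - e <= q ^+ n].
Proof.
move=> e0; pose x : R := Num.min 1 e / n.+1%:R.
have m0 : 0 < Num.min 1 e by rewrite lt_min ltr01.
have n0 : 0 < n.+1%:R :> R by rewrite ltr0n.
have x0 : 0 < x by rewrite divr_gt0.
have x1 : x <= 1.
  by rewrite ler_pdivrMr// mul1r ge_min ler1n.
have bern k : 1 - k%:R * x <= (1 - x) ^+ k.
  elim: k => [|k ih]; first by rewrite expr0 mul0r subr0.
  rewrite exprS -natr1.
  have := ler_wpM2l (_ : 0 <= 1 - x) ih; rewrite subr_ge0 => /(_ x1).
  by apply: le_trans; have : 0 <= k%:R :> R by []; nra.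
exists (1 - x); split; [lra|lra|].
apply: le_trans (bern n); suff : n%:R * x <= e by lra.
apply: (@le_trans _ _ (n.+1%:R * x)); first by rewrite ler_pM2r// ler_nat.
by rewrite mulrC divfK ?gt_eqF// ge_min lexx orbT.
Qed.

Lemma exists_max_seq (R : realType) (I : eqType) (l : seq I) (h : I -> R) :
  l != [::] -> exists2 t, t \in l & forall u, u \in l -> h u <= h t.
Proof.
elim: l => // x l ih _; have [l0|/ih [t tl ht]] := eqVneq l [::].
  by exists x; rewrite l0 ?mem_head// => u; rewrite inE => /eqP ->.
have [xt|tx] := leP (h x) (h t).
  by exists t; [rewrite inE tl orbT|move=> u; rewrite inE => /orP[/eqP ->|/ht]].
exists x; first exact: mem_head.
move=> u; rewrite inE => /orP[/eqP ->//|/ht]; lra.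
Qed.

(** This is how finite branching enters the estimates: horizons that depend on the successor are
    replaced by one common horizon. *)
Lemma uniform_seq (I : eqType) (l : seq I) (Q : I -> nat -> Prop) :
  (forall t m n, (m <= n)%N -> Q t m -> Q t n) ->
  (forall t, t \in l -> exists n, Q t n) ->
  exists n, forall t, t \in l -> Q t n.
Proof.
move=> Qmono; elim: l => [|x l ih] Ql; first by exists 0%N.
have [n1 h1] := Ql x (mem_head _ _).
have [t tl|n2 h2] := ih; first by apply: Ql; rewrite inE tl orbT.
exists (maxn n1 n2) => t; rewrite inE => /orP[/eqP ->|/h2].
  exact: Qmono (leq_maxl _ _) h1.
exact: Qmono (leq_maxr _ _).
Qed.

Lemma esum_finite_support (R : realType) (S : choiceType) (a : S -> \bar R)
    (l : seq S) : uniq l -> (forall t, 0 <= a t)%E ->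
  (forall t, t \notin l -> a t = 0%E) ->
  (\esum_(t in [set: S]) a t = \sum_(t <- l) a t)%E.
Proof.
move=> ul a0 al; transitivity (\esum_(t in [set` l]) a t)%E.
  rewrite [RHS]esum_mkcond; apply: eq_esum => t _; case: ifPn => //.
  by move=> tl; rewrite al//; apply: contra tl => tl; rewrite inE.
rewrite esum_fset; last 2 first.
- exact: finite_seq.
- by move=> t _; exact: a0.
by apply: esym; exact: fsbig_seq.
Qed.

Lemma distr_sum1 (R : realType) (S : countType) (d : distr R S) (l : seq S) :
  uniq l -> (forall t, t \notin l -> d t = 0) -> \sum_(t <- l) d t = 1.
Proof.
move=> ul dl; apply: EFin_inj; rewrite -(mass_sum1 d) -sumEFin.
rewrite (@esum_finite_support _ _ _ l)// => t; first by rewrite lee_fin mass_ge0.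
by move/dl => ->.
Qed.

(** * Finite-horizon values of reaching [T] while avoiding [L] *)

Section values.
Context (R : realType) (S : countType) (G : game R S) (T : set S).
Context (hG : finitely_branching G).

(* Successors that a random state reaches with probability 0 are dropped. *)
Definition succ (s : S) : seq S :=
  let: exist l _ := cid ((finite_seqP _).1 (hG s)) in
  undup [seq t <- l | (owner G s) || (0 < rand G s t)].

Lemma succ_uniq s : uniq (succ s).
Proof. by rewrite /succ; case: cid => l _; exact: undup_uniq. Qed.

Lemma mem_succ s t :
  (t \in succ s) = `[<edge G s t>] && ((owner G s) || (0 < rand G s t)).
Proof.
rewrite /succ; case: cid => l El; rewrite mem_undup mem_filter andbC.
congr (_ && _); apply/idP/asboolP => [tl|].
  by have : [set` l] t := tl; rewrite -El.
by move=> e; have : [set s' | edge G s s'] t := e; rewrite El.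
Qed.

Lemma succ_edge s t : t \in succ s -> edge G s t.
Proof. by rewrite mem_succ => /andP[/asboolP]. Qed.

Lemma succ_neq0 s : succ s != [::].
Proof.
apply/eqP => s0; case Es : (owner G s) => [p|].
  have [t st] := edge_total G s.
  by have := mem_succ s t; rewrite s0 in_nil Es orTb andbT => /esym/asboolP.
have := @distr_sum1 R S (rand G s) [::] isT; rewrite big_nil => H.
have /eqP : 0 = 1 :> R; last by rewrite eq_sym oner_eq0.
apply: H => t _; have [st|nst] := pselect (edge G s t); last first.
  exact: rand_supported nst.
have := mem_succ s t; rewrite s0 in_nil Es asboolT//= => /esym/negbT.
by rewrite lt_neqAle mass_ge0 andbT negbK => /eqP.
Qed.

Lemma rand_sum1 s : owner G s = None -> \sum_(t <- succ s) rand G s t = 1.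
Proof.
move=> Es; apply: distr_sum1; first exact: succ_uniq.
move=> t; rewrite mem_succ Es /=; have [st|nst] := pselect (edge G s t).
  rewrite asboolT//= lt_neqAle mass_ge0 andbT negbK => /eqP //.
by move=> _; exact: rand_supported nst.
Qed.

(* [L] is a set of states that Box must avoid: reaching it counts as losing.
   A partial map [c] fixes the moves of Box on its domain. *)
Context (L : set S).
Implicit Types (c : S -> option S) (h k u : S -> R) (s t : S).

Definition options c s : seq S :=
  if owner G s is Some Box then
    if c s is Some t then [:: t] else [seq t <- succ s | t \notin L]
  else succ s.

(* Whether the current state is in [T] is immaterial: [value c n s] concerns
   visiting [T] within between 1 and [n] steps. *)
Definition arrive h t : R := if t \in L then 0 else if t \in T then 1 else h t.

(** The default 0 of the maximum makes Box lose when every move leads into [L]. The default 1 of the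
    minimum is harmless, since [succ s] is never empty and arrival values are at most 1. *)
Definition bellman c h s : R :=
  match owner G s with
  | Some Box => \big[Num.max/0]_(t <- options c s) arrive h t
  | Some Diamond => \big[Num.min/1]_(t <- succ s) arrive h t
  | None => \sum_(t <- succ s) rand G s t * arrive h t
  end.

Definition unit_valued h := forall s, 0 <= h s <= 1.

Lemma arrive_unit h t : unit_valued h -> 0 <= arrive h t <= 1.
Proof.
move=> h01; rewrite /arrive; case: ifP => _; first by rewrite lexx ler01.
by case: ifP => _ //; rewrite ler01 lexx.
Qed.

Lemma bellman_unit c h : unit_valued h -> unit_valued (bellman c h).
Proof.
move=> h01 s; rewrite /bellman; case Es: (owner G s) => [[]|].
- apply/andP; split; first exact: bigmax_ge_id.
  by apply: bigmax_le => // t _; have /andP[] := arrive_unit t h01.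
- apply/andP; split; last exact: bigmin_le_id.
  by apply: le_bigmin => // t _; have /andP[] := arrive_unit t h01.
- apply/andP; split.
    apply: sumr_ge0 => t _; have /andP[? _] := arrive_unit t h01.
    by rewrite mulr_ge0// mass_ge0.
  rewrite -(rand_sum1 Es); apply: ler_sum => t _.
  have /andP[_ ?] := arrive_unit t h01.
  by rewrite ler_piMr// mass_ge0.
Qed.

Lemma bellman_box_attained c h s : unit_valued h ->
  owner G s = Some Box -> options c s != [::] ->
  exists2 t, t \in options c s & bellman c h s = arrive h t.
Proof.
move=> h01 Es cs; have [t ts ht] := exists_max_seq (arrive h) cs; exists t => //.
rewrite /bellman Es; apply/eqP; rewrite eq_le; apply/andP; split.
  rewrite big_seq_cond; apply: bigmax_le => [|u /andP[us _]]; last exact: ht.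
  by have /andP[] := arrive_unit t h01.
exact: le_bigmax_seq.
Qed.

(** The one-step operator commutes with affine rescaling up to boundary effects; all later
    comparisons of values are instances. The bound [a + b <= 1] copes with the default of the
    minimum. The disjunction copes with a Box state without options, where the left side collapses
    to [a]. *)
Lemma bellman_affine c c' h k s (a b : R) :
  unit_valued h -> unit_valued k -> 0 <= b -> a + b <= 1 ->
  (options c s != [::] \/ a <= 0) -> {subset options c s <= options c' s} ->
  (forall t, t \in options c s -> a + b * arrive h t <= arrive k t) ->
  a + b * bellman c h s <= bellman c' k s.
Proof.
move=> h01 k01 b0 ab1 cs cc' hk; case Es: (owner G s) => [[]|].
- have [c0|/(bellman_box_attained h01 Es)[t ts ->]] := eqVneq (options c s) [::].
    rewrite {1}/bellman Es c0 big_nil mulr0 addr0.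
    have /andP[? _] := bellman_unit c' k01 s.
    by case: cs => [|/le_trans->//]; rewrite c0.
  apply: le_trans (hk _ ts) _; rewrite /bellman Es.
  by apply: le_bigmax_seq => //; exact: cc'.
- rewrite {2}/bellman Es big_seq_cond; apply: le_bigmin.
    have /andP[_ ?] := bellman_unit c h01 s.
    by apply: le_trans ab1; rewrite lerD2l ler_piMr.
  move=> t /andP[ts _]; have := hk t; rewrite {1}/options Es => /(_ ts).
  apply: le_trans; rewrite lerD2l ler_wpM2l// /bellman Es.
  exact: ge_bigmin_seq.
- rewrite /bellman Es -[a]mulr1 -(rand_sum1 Es) !mulr_sumr -big_split/=.
  rewrite big_seq [leRHS]big_seq; apply: ler_sum => t ts.
  have := hk t; rewrite {1}/options Es => /(_ ts) /(ler_wpM2l (mass_ge0 (rand G s) t)).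
  by apply: le_trans; rewrite le_eqVlt; apply/orP; left; apply/eqP; ring.
Qed.

Lemma bellman_mono c h k s : unit_valued h -> unit_valued k ->
  (forall t, h t <= k t) -> bellman c h s <= bellman c k s.
Proof.
move=> h01 k01 hk; rewrite -[leLHS]mul1r -[leLHS]add0r.
apply: bellman_affine => //; rewrite ?add0r//; first by right.
move=> t _; rewrite add0r mul1r /arrive.
by case: ifP => // _; case: ifP.
Qed.

Definition value c n : S -> R := iter n (bellman c) (fun=> 0).

Lemma value_unit c n : unit_valued (value c n).
Proof.
by elim: n => [s|n ih]; [rewrite lexx ler01|exact: bellman_unit].
Qed.

Lemma value_leS c n s : value c n s <= value c n.+1 s.
Proof.
elim: n s => [|n ih] s; first by have /andP[] := value_unit c 1 s.
exact: (bellman_mono c s (value_unit c n) (value_unit c n.+1) ih).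
Qed.

Lemma value_le c s m n : (m <= n)%N -> value c m s <= value c n s.
Proof.
elim: n => [|n ih]; first by rewrite leqn0 => /eqP ->.
rewrite leq_eqVlt => /orP[/eqP -> //|]; rewrite ltnS => /ih /le_trans; apply.
exact: value_leS.
Qed.

(** * Lower bounds on values: restarting and discounted certificates *)

Definition reaches c (p : R) := forall s, ~ L s -> exists n, p <= value c n s.

Definition viable c := forall s, ~ L s -> options c s != [::] /\
  forall t, t \in options c s -> ~ L t.

Lemma not_L_in t : ~ L t -> (t \in L) = false.
Proof. by move=> Lt; apply/negbTE; rewrite notin_setE. Qed.

(* Restarting from scratch whenever the first N steps fail. *)
Lemma reaches_restart c p : viable c -> 0 <= p -> p <= 1 -> reaches c p ->
  forall N s, ~ L s -> exists n, p + (1 - p) * value c N s <= value c n s.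
Proof.
move=> vc p0 p1 rp; elim=> [|N ih] s Ls.
  by have [n sn] := rp s Ls; exists n; rewrite mulr0 addr0.
have [sn sL] := vc s Ls.
have [n nP] : exists n, forall t, t \in options c s ->
    p + (1 - p) * value c N t <= value c n t.
  apply: (@uniform_seq _ _ (fun t n => p + (1 - p) * value c N t <= value c n t)).
    by move=> t m n mn /le_trans; apply; exact: value_le.
  by move=> t /sL/ih.
exists n.+1; apply: bellman_affine; rewrite ?subr_ge0 ?subrKC//; do ?exact: value_unit.
  by left.
move=> t ts; rewrite /arrive not_L_in; last exact: sL.
by case: ifP => _; [rewrite mulr1 subrKC|exact: nP].
Qed.

(** After [k] rounds the failure probability is at most [(1 - p) ^+ k]: a first attempt of [N] steps
    succeeds with probability [p], and on failure the bound for the remaining rounds applies. *)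
Lemma reaches_amplify c p : viable c -> 0 < p -> p <= 1 -> reaches c p ->
  forall e, 0 < e -> reaches c (1 - e).
Proof.
move=> vc p0 p1 rp e e0.
have r (k : nat) : reaches c (1 - (1 - p) ^+ k).
  elim: k => [|k ih] s Ls.
    by exists 0%N; rewrite expr0 subrr.
  have [N sN] := rp s Ls.
  have q0 : 0 <= (1 - p) ^+ k by rewrite exprn_ge0// subr_ge0.
  have q1 : (1 - p) ^+ k <= 1 by rewrite exprn_ile1 ?subr_ge0// lerBlDr lerDl ltW.
  have := @reaches_restart c (1 - (1 - p) ^+ k) vc.
  rewrite subr_ge0 lerBlDr lerDl => /(_ q1 q0 ih N s Ls)[n nP].
  by exists n; apply: le_trans nP; rewrite exprS; nra.
have [| |k ke] := @expr_small R (1 - p) e _ _ e0; [lra|lra|].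
move=> s Ls; have [n sn] := r k s Ls; exists n; apply: le_trans sn; lra.
Qed.

(* A discount factor [q < 1] forces the lower bound [h] to be realised within
   finite time, also by a memoryless choice of moves. *)
Definition certificate c (q : R) h :=
  [/\ 0 <= q, q < 1, unit_valued h & forall s, h s <= q * bellman c h s].

(** Each unfolding of [h <= q * bellman c h] gains a factor [q], so the part of [h] that is not
    realised within [n] steps is at most [q ^+ n]. *)
Lemma certificate_value c q h n s :
  certificate c q h -> h s <= value c n s + q ^+ n.
Proof.
move=> [q0 q1 h01 hq]; elim: n s => [|n ih] s.
  by rewrite add0r expr0; have /andP[] := h01 s.
have qn0 : 0 <= q ^+ n by rewrite exprn_ge0.
have : - q ^+ n + 1 * bellman c h s <= bellman c (value c n) s.
  apply: bellman_affine => //; first exact: value_unit.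
  - lra.
  - by right; rewrite oppr_le0.
  - move=> t _; have := ih t; rewrite /arrive mul1r.
    by case: ifP => _; [move=> _; lra|case: ifP => _; lra].
move: (hq s) (bellman_unit c (value_unit c n) s); rewrite exprS => hs /andP[v0 v1] hv.
change (value c n.+1 s) with (bellman c (value c n) s); nra.
Qed.

Lemma certificate_reaches c q h s p : certificate c q h -> p < h s ->
  exists n, p <= value c n s.
Proof.
move=> ch ph; have [q0 q1 _ _] := ch.
have [|n nP] := @expr_small R q (h s - p) q0 q1; first by rewrite subr_gt0.
by exists n; have := certificate_value n s ch; lra.
Qed.

(** The certificate is the discounted value, a supremum over all horizons [m]. Taking [q] so close
    to 1 that [1 - (p - p') <= q ^+ n] makes the discount at horizon [n] cost at most [p - p']. *)
Lemma value_certificate c p p' n s : p <= value c n s -> p' < p ->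
  exists q h, certificate c q h /\ p' <= h s.
Proof.
move=> pn pp'; have [|q [q0 q1 qn]] := @expr_close_to1 R n (p - p').
  by rewrite subr_gt0.
pose A t := range (fun m => q ^+ m * value c m t).
have q1n m : q ^+ m <= 1 by rewrite exprn_ile1// ltW.
have qm m : 0 <= q ^+ m by rewrite exprn_ge0.
have A1 t : ubound (A t) 1.
  move=> _ [m _ <-]; have /andP[? ?] := value_unit c m t.
  by rewrite mulr_ile1.
have hA t m : q ^+ m * value c m t <= sup (A t).
  by apply: ub_le_sup; [exists 1; exact: A1|exists m].
have A0 t : A t !=set0 by exists (q ^+ 0 * value c 0 t); exists 0%N.
exists q, (fun t => sup (A t)); split; last first.
  by apply: le_trans (hA s n); have := value_unit c n s; nra.
have h01 : unit_valued (fun t => sup (A t)).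
  move=> t; apply/andP; split; last exact: (ge_sup (A0 t) (A1 t)).
  by have := hA t 0%N; rewrite mulr0.
split=> // t; apply: ge_sup => // _ [[|m] _ <-].
  by rewrite mulr0 mulr_ge0//; have /andP[] := bellman_unit c h01 t.
(* One factor [q] pays for the current step; the remaining [q ^+ m] also scales an arrival in [T],
   which is harmless as it is at most 1. *)
rewrite exprS -mulrA ler_wpM2l// -[leLHS]add0r.
apply: bellman_affine => //; rewrite ?add0r//; first exact: value_unit.
  by right.
move=> u _; rewrite add0r /arrive; case: ifP => _; first by rewrite mulr0.
by case: ifP => _; rewrite ?mulr1//; exact: hA.
Qed.

(** * Value 1 outside [L], and fixing the moves of Box state by state *)

Definition full c := forall e, 0 < e -> reaches c (1 - e).

Definition no_choice : S -> option S := fun=> None.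

Definition legal c := forall s t, c s = Some t -> t \in options no_choice s.

Lemma options_legal c s : legal c -> {subset options c s <= options no_choice s}.
Proof.
move=> lc t; rewrite /options; case Es: (owner G s) => [[]|] //.
case cs: (c s) => [u|] //=; rewrite inE => /eqP ->.
by have := lc s u cs; rewrite /options Es.
Qed.

Lemma viable_legal c : viable no_choice -> legal c -> viable c.
Proof.
move=> vf lc s Ls; have [fn fL] := vf s Ls; split; last first.
  by move=> t /(options_legal lc)/fL.
move: fn; rewrite /options; case: (owner G s) => [[]|] //.
by case: (c s).
Qed.

(** A Diamond move into [L] would make the value 0, and a random move into [L] would bound it away
    from 1. The latter needs positive mass, hence the removal of null successors in [succ]. *)
Lemma full_viable : full no_choice -> viable no_choice.
Proof.
move=> ff s Ls; have he : 0 < 1 / 2 :> R by lra.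
have [n ns] := ff _ he s Ls; have [v0 v1] := andP (value_unit no_choice n s).
case: n ns v0 v1 => [/=|n ns _ _]; first by move=> + _ _; lra.
split.
  apply/eqP => o0; case Es: (owner G s) => [[]|].
  - by move: ns; rewrite /= /bellman Es o0 big_nil; lra.
  - by move: o0 (succ_neq0 s); rewrite /options Es => ->.
  - by move: o0 (succ_neq0 s); rewrite /options Es => ->.
move=> t ts Lt; have La h : arrive h t = 0 by rewrite /arrive mem_set.
move: ts; rewrite /options; case Es: (owner G s) => [[]|].
- by rewrite mem_filter mem_set.
- move=> ts; move: ns; rewrite /= /bellman Es.
  have := @ge_bigmin_seq _ R _ (succ s) 1 t predT (arrive (value no_choice n)) ts isT.
  by rewrite La; lra.
- move=> ts; have pt : 0 < rand G s t.
    by move: ts; rewrite mem_succ Es => /andP[].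
  have p2 : 0 < rand G s t / 2 by lra.
  have p1 := rand_sum1 Es; move: (p1); rewrite (bigD1_seq t)//= ?succ_uniq// => pE.
  have r0 : 0 <= \sum_(i <- succ s | i != t) rand G s i.
    by apply: sumr_ge0 => u _; exact: mass_ge0.
  have [[/=|m] ms] := ff _ p2 s Ls; first by lra.
  suff : value no_choice m.+1 s <= \sum_(i <- succ s | i != t) rand G s i by lra.
  rewrite /= /bellman Es (bigD1_seq t)//= ?succ_uniq// La mulr0 add0r.
  apply: ler_sum => u _; have /andP[_ ?] := arrive_unit u (value_unit no_choice m).
  by rewrite ler_piMr// mass_ge0.
Qed.

Lemma bellman_options c c' h s :
  options c s = options c' s -> bellman c h s = bellman c' h s.
Proof. by move=> cc; rewrite /bellman cc. Qed.

(* Ornstein's argument: fixing the moves that a discounted optimum [u]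
   prescribes where [u >= 1/2] keeps the values bounded away from 0, and the
   restriction alone already guarantees half of the excess of [u] over 1/2. *)
Lemma fix_moves c s0 : viable no_choice -> legal c -> full c -> ~ L s0 ->
  exists c', [/\ legal c', full c', forall s t, c s = Some t -> c' s = Some t &
    forall d, (forall s t, c' s = Some t -> d s = Some t) ->
      exists n, 1 / 4 <= value d n s0].
Proof.
move=> vf lc fc Ls0; have e8 : 0 < 1 / 8 :> R by lra.
(* The height 3/4 leaves room for both transformations below: halving gives 3/8 and [2 * u - 1]
   gives 1/2, each above 1/4. *)
have cert s : ~ L s -> exists q h, certificate c q h /\ 3 / 4 <= h s.
  move=> Ls; have [n ns] := fc _ e8 s Ls.
  by apply: value_certificate ns _; lra.
have [q [u [cu us0]]] := cert s0 Ls0; have [q0 q1 u01 uq] := cu.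
pose Q s o := match o with
  | None => c s = None /\ (owner G s = Some Box -> u s < 1 / 2)
  | Some t => c s = Some t \/ [/\ c s = None, owner G s = Some Box, 1 / 2 <= u s,
      t \in options c s & bellman c u s = arrive u t] end.
have [c' c'P] : {c' : S -> option S & forall s, Q s (c' s)}.
  apply: (@choice _ _ Q) => s; case cs: (c s) => [t|]; first by exists (Some t); left.
  have [[us Es]|nus] := pselect (1 / 2 <= u s /\ owner G s = Some Box); last first.
    exists None; split => // Es; rewrite ltNge; apply/negP => us; exact: nus.
  have os : options c s != [::].
    apply/eqP => o0; have := uq s; rewrite /bellman Es o0 big_nil mulr0; lra.
  have [t ts tE] := bellman_box_attained u01 Es os.
  by exists (Some t); right.
have c'c s t : c s = Some t -> c' s = Some t.
  by move=> cs; have := c'P s; rewrite /Q; case: (c' s) => [t'|]; rewrite cs => -[]// [].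
have lc' : legal c'.
  move=> s t c's; have := c'P s; rewrite /Q c's => -[/lc//|[_ _ _ ts _]].
  exact: options_legal ts.
have vc' := viable_legal vf lc'.
have opt' s : c' s = c s -> options c' s = options c s by rewrite /options => ->.
(* The new moves are optimal for [u], so [u] remains a certificate under [c']. *)
have cc' s : bellman c u s <= bellman c' u s.
  have := c'P s; rewrite /Q; case c's: (c' s) => [t|].
    move=> [cs|[_ Es _ _ ->]]; first by rewrite (@bellman_options c c')// opt'// c's.
    rewrite /bellman Es /options Es c's.
    by apply: le_bigmax_seq => //; rewrite mem_head.
  by move=> [cs _]; rewrite (@bellman_options c c')// opt'// c's.
have r4 : reaches c' (1 / 4).
  move=> s Ls; have [p [v [[p0 p1 v01 vp] vs]]] := cert s Ls.
  (* Where [u] is the larger term, its own certificate serves. Elsewhere [u < 1 / 2], because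
     [v <= 1]; there [c'] fixes nothing new, and the certificate of [v], halved, still applies. *)
  pose h t := Num.max (u t) (1 / 2 * v t).
  have h01 : unit_valued h.
    move=> t; rewrite /h le_max ge_max; have /andP[-> ->] := u01 t.
    by have /andP[_ ?] := v01 t; lra.
  have mp : p <= Num.max q p by rewrite le_max lexx orbT.
  have mq : q <= Num.max q p by rewrite le_max lexx.
  apply: (@certificate_reaches c' (Num.max q p) h); last first.
    by rewrite lt_max; apply/orP; right; lra.
  split => //; [by rewrite le_max q0|by rewrite gt_max q1 p1|].
  move=> t; have [B0 _] := andP (bellman_unit c' h01 t).
  have [vu|uv] := leP (1 / 2 * v t) (u t).
    rewrite {1}/h (max_idPl vu); apply: le_trans (uq t) _.
    apply: ler_pM => //; first by have /andP[] := bellman_unit c u01 t.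
    apply: le_trans (cc' t) _; apply: bellman_mono => // x.
    by rewrite /h le_max lexx.
  rewrite {1}/h (max_idPr (ltW uv)).
  have ct : c' t = c t.
    have := c'P t; rewrite /Q; case c't: (c' t) => [x|].
      move=> [->//|[_ _ ut _ _]]; exfalso.
      by have /andP[_ ?] := v01 t; lra.
    by move=> [->].
  apply: le_trans (_ : p * (0 + 1 / 2 * bellman c v t) <= _).
    by have := vp t; lra.
  apply: ler_pM => //; first by have /andP[? _] := bellman_unit c v01 t; lra.
  apply: bellman_affine => //; [lra|by right|by rewrite opt'|].
  move=> x _; rewrite /arrive; case: ifP => _; first by lra.
  by case: ifP => _; [lra|rewrite add0r /h le_max lexx orbT].
exists c'; split => //; first by apply: reaches_amplify r4 => //; lra.
(* This [h] is positive only where [u > 1 / 2]. There [c'] prescribes a move at every Box state, so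
   that every extension [d] has the same options. *)
move=> d dc'; pose h t := Num.max 0 (2 * u t - 1).
have h01 : unit_valued h.
  by move=> t; rewrite /h le_max lexx ge_max ler01/=; have /andP[_ ?] := u01 t; lra.
apply: (@certificate_reaches d q h); last by rewrite lt_max; apply/orP; right; lra.
split => // t; have [B0 _] := andP (bellman_unit d h01 t).
have [u2|u2] := leP (2 * u t - 1) 0; first by rewrite {1}/h (max_idPl u2) mulr_ge0.
rewrite {1}/h (max_idPr (ltW u2)).
have od : options d t = options c' t.
  rewrite /options; case Et: (owner G t) => [[]|]//.
  have := c'P t; rewrite /Q; case c't: (c' t) => [x|]; first by rewrite (dc' _ _ c't).
  by move=> [_ /(_ Et) ut]; exfalso; lra.
have : - 1 + 2 * bellman c' u t <= bellman d h t.
  apply: bellman_affine => //; [by right; lra|by rewrite od|].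
  move=> x _; rewrite /arrive; case: ifP => _; first by lra.
  by case: ifP => _; [lra|rewrite /h le_max addrC lexx orbT].
by have := uq t; have := cc' t; nra.
Qed.

(** Stage [n] treats the state with code [n]. Moves once fixed are never revised, so the stages have
    a common extension [f]; it inherits the guarantee 1/4 of every stage, and restarting raises this
    to 1. *)
Lemma memoryless_choice : full no_choice -> exists f : S -> S,
  [/\ forall s, f s \in succ s, viable (fun s => Some (f s)) &
      full (fun s => Some (f s))].
Proof.
move=> ff; have vf := full_viable ff.
pose good c := legal c /\ full c.
pose P c s0 c' := ~ L s0 -> good c -> [/\ legal c', full c',
    forall s t, c s = Some t -> c' s = Some t &
    forall d, (forall s t, c' s = Some t -> d s = Some t) ->
      exists n, 1 / 4 <= value d n s0].
have [F FP] : {F : (S -> option S) * S -> S -> option S &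
    forall x, P x.1 x.2 (F x)}.
  apply: (@choice _ _ (fun x c' => P x.1 x.2 c')) => -[c s0] /=.
  have [[Ls0 [lc fc]]|ng] := pselect (~ L s0 /\ good c); last first.
    by exists c => Ls0 gc; case: ng.
  by have [c' c'P] := fix_moves vf lc fc Ls0; exists c'.
pose next c n := if unpickle n is Some s then
  if s \in L then c else F (c, s) else c.
pose C := fix C n := if n is m.+1 then next (C m) m else no_choice.
have Cgood n : good (C n).
  elim: n => [|n ih]; first by split.
  rewrite /= /next; case: (unpickle n) => [s|//]; case: ifPn => //.
  by rewrite notin_setE => Ls; have [] := FP (C n, s) Ls ih.
have CS n s t : C n s = Some t -> C n.+1 s = Some t.
  rewrite /= /next; case: (unpickle n) => [x|//]; case: ifPn => //.
  by rewrite notin_setE => Lx; have [_ _ + _] := FP (C n, x) Lx (Cgood n); exact.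
have Cle m n s t : (m <= n)%N -> C m s = Some t -> C n s = Some t.
  elim: n => [|n ih]; first by rewrite leqn0 => /eqP ->.
  by rewrite leq_eqVlt => /orP[/eqP -> //|]; rewrite ltnS => /ih h /h; exact: CS.
have sub s : {subset options no_choice s <= succ s}.
  move=> t; rewrite /options; case: (owner G s) => [[]|]//.
  by rewrite mem_filter => /andP[].
have [f fP] : {f : S -> S & forall s, [/\ f s \in succ s,
    (~ L s -> f s \in options no_choice s) & forall n t, C n s = Some t -> f s = t]}.
  apply: (@choice _ _ (fun s y => [/\ y \in succ s,
    (~ L s -> y \in options no_choice s) & forall n t, C n s = Some t -> y = t])) => s.
  have [[n [t nt]]|nC] := pselect (exists n t, C n s = Some t).
    have ts := (Cgood n).1 _ _ nt; exists t; split => //; first exact: sub.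
    move=> m u mu; have [mn|/ltnW nm] := leqP m n.
      by have := Cle _ _ _ _ mn mu; rewrite nt => -[].
    by have := Cle _ _ _ _ nm nt; rewrite mu => -[].
  have nC' y n t : C n s = Some t -> y = t by move=> nt; case: nC; exists n, t.
  have hd (l : seq S) : l != [::] -> exists y, y \in l.
    by case: l => // y l _; exists y; exact: mem_head.
  (* Moves left free by all stages are completed arbitrarily: inside [L] by any successor, outside
     by an option, which keeps [f] viable. *)
  have [Ls|Ls] := pselect (L s).
    by have [y ys] := hd _ (succ_neq0 s); exists y; split => //; exact: nC'.
  by have [y ys] := hd _ (vf s Ls).1; exists y; split => //; [exact: sub|exact: nC'].
have vF : viable (fun s => Some (f s)).
  move=> s Ls; have [fn fL] := vf s Ls; have [fs /(_ Ls)/fL fo _] := fP s.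
  move: fn fL; rewrite /options; case: (owner G s) => [[]|] //= _ _.
  by split => // t; rewrite inE => /eqP ->.
exists f; split => //; first by move=> s; have [] := fP s.
apply: (@reaches_amplify _ (1 / 4)) => //; first lra.
(* The guarantee from [s] is created at stage [(pickle s).+1], which [f] extends. *)
move=> s Ls; have [_ _ _] := FP (C (pickle s), s) Ls (Cgood _).
apply=> x t; have -> : F (C (pickle s), s) = C (pickle s).+1.
  by rewrite /= /next pickleK memNset.
by move=> xt; have [_ _ /(_ _ _ xt) ->] := fP x.
Qed.

(** * The limit of the finite-horizon values *)

Definition limit_value s : R := sup (range (fun n => value no_choice n s)).

Lemma value_le_limit n s : value no_choice n s <= limit_value s.
Proof.
apply: ub_le_sup; last by exists n.
by exists 1 => _ [m _ <-]; have /andP[] := value_unit no_choice m s.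
Qed.

Lemma limit_value_le s a : (forall n, value no_choice n s <= a) -> limit_value s <= a.
Proof.
move=> va; apply: ge_sup; first by exists (value no_choice 0 s); exists 0%N.
by move=> _ [n _ <-].
Qed.

Lemma limit_value_unit : unit_valued limit_value.
Proof.
move=> s; rewrite (value_le_limit 0 s)/=; apply: limit_value_le => n.
by have /andP[] := value_unit no_choice n s.
Qed.

(** As there are finitely many options, one horizon [n] approximates the limit up to [e] at all of
    them; then [value n.+1] is within [e] of the left side. *)
Lemma bellman_limit_le s : bellman no_choice limit_value s <= limit_value s.
Proof.
apply/ler_addgt0Pl => e e0.
have [n nP] : exists n, forall t, t \in options no_choice s ->
    limit_value t - e <= value no_choice n t.
  apply: (@uniform_seq _ _ (fun t n => limit_value t - e <= value no_choice n t)).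
    by move=> t m n mn /le_trans; apply; exact: value_le.
  move=> t _; apply: contrapT => /forallNP ne.
  suff : limit_value t <= limit_value t - e by lra.
  by apply: limit_value_le => n; have /negP := ne n; rewrite -ltNge => /ltW.
have : - e + 1 * bellman no_choice limit_value s <=
    bellman no_choice (value no_choice n) s.
  apply: bellman_affine => //.
  - exact: limit_value_unit.
  - exact: value_unit.
  - lra.
  - by right; lra.
  - move=> t ts; have := nP t ts; rewrite /arrive mul1r.
    by case: ifP => _; [move=> _; lra|case: ifP => _; lra].
have : bellman no_choice (value no_choice n) s <= limit_value s := value_le_limit n.+1 s.
lra.
Qed.

Lemma limit_value_full : (forall s, ~ L s -> 1 <= limit_value s) -> full no_choice.
Proof.
move=> h e e0 s Ls; apply: contrapT => /forallNP ne.
suff : limit_value s <= 1 - e by have := h s Ls; lra.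
by apply: limit_value_le => n; have /negP := ne n; rewrite -ltNge => /ltW.
Qed.

Lemma diamond_minimizer c h s : unit_valued h -> owner G s = Some Diamond ->
  exists2 t, t \in succ s & arrive h t <= bellman c h s.
Proof.
move=> h01 Es; have [t ts ht] := exists_max_seq (fun t => - arrive h t) (succ_neq0 s).
exists t => //; rewrite /bellman Es big_seq_cond; apply: le_bigmin.
  by have /andP[] := arrive_unit t h01.
by move=> u /andP[us _]; have := ht u us; rewrite lerN2.
Qed.
End values.

(** * Runs that miss [T] during a window of time *)

Section quiet_runs.
Context (R : realType) (S : countType) (T : set S).

Lemma cylinder_rcons (v : seq S) t (r : nat -> S) :
  cylinder (rcons v t) r <-> cylinder v r /\ r (size v) = t.
Proof.
rewrite /cylinder/= size_rcons /mkseq -addn1 iotaD map_cat cats1 add0n.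
by split=> [/rcons_inj[]//|[-> ->]].
Qed.

(** With [i] the length of a history, the window starts just after its last state, in accordance
    with [value], which ignores the current state. *)
Definition quiet i n : set (nat -> S) :=
  [set r | forall j, (i <= j < i + n)%N -> ~ T (r j)].

Lemma measurable_visit (s0 : S) j : measurable ([set r | T (r j)] : set (runs s0)).
Proof.
rewrite (_ : mkset _ = \bigcup_(w : seq S)
    if (size w == j) then \bigcup_(t in T) cylinder (rcons w t) else set0).
  apply: countable_bigcupT_measurable => // w; case: ifP => // _.
  rewrite bigcup_mkcond; apply: countable_bigcupT_measurable => // t.
  by case: ifP => // _; exact: measurable_cylinder.
apply/seteqP; split=> r /=.
  move=> Tr; exists (mkseq r j) => //; rewrite size_mkseq eqxx.
  exists (r j) => //; apply/cylinder_rcons; rewrite size_mkseq; split=> //.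
  by rewrite /cylinder/= size_mkseq.
by move=> [w _]; case: eqP => // sw [t Tt] /cylinder_rcons[_]; rewrite sw => ->.
Qed.

Lemma measurable_quiet (s0 : S) i n : measurable (quiet i n : set (runs s0)).
Proof.
rewrite (_ : quiet i n = \bigcap_(j in [set j | (i <= j < i + n)%N])
    ~` [set r : runs s0 | T (r j)]); last by apply/seteqP; split.
by apply: bigcap_measurableType => j _; apply: measurableC; exact: measurable_visit.
Qed.

Lemma quiet0 i : quiet i 0 = setT.
Proof.
apply/seteqP; split=> // r _ j; rewrite addn0 => /andP[ij /(leq_ltn_trans ij)].
by rewrite ltnn.
Qed.

Lemma cylinder_quietS (v : seq S) t n :
  cylinder (rcons v t) `&` quiet (size v) n.+1 =
  if t \in T then set0 else cylinder (rcons v t) `&` quiet (size (rcons v t)) n.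
Proof.
case: ifPn => [/set_mem Tt|/negP tT]; apply/seteqP; split=> r //=.
- move=> [/cylinder_rcons[_ rt] /(_ (size v))]; rewrite rt; apply=> //.
  by rewrite leqnn addnS ltnS leq_addr.
- move=> [cr qr]; split=> // j /andP[vj jn]; apply: qr.
  by move: vj jn; rewrite size_rcons addSn addnS => /ltnW -> ->.
- move=> [cr qr]; split=> // j; rewrite leq_eqVlt => /andP[/orP[/eqP <- _|vj jn]].
    by move/cylinder_rcons : cr => [_ ->] /mem_set.
  by apply: qr; rewrite size_rcons vj addSn -addnS.
Qed.

(** One inequality is countable subadditivity over all one-letter extensions, those outside [l]
    being null; the other is finite additivity over the disjoint extensions by letters of [l]. *)
Lemma cylinder_split (s0 : S) (k : seq S -> distr R S) v (l : seq S)
    (F : set (runs s0)) :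
  uniq l -> (forall t, t \notin l -> k v t = 0) -> measurable F ->
  (word_measure s0 k (cylinder v `&` F) =
   \sum_(t <- l) word_measure s0 k (cylinder (rcons v t) `&` F))%E.
Proof.
move=> ul kl mF; pose E c : set (runs s0) := cylinder c `&` F.
have mE c : measurable (E c) by apply: measurableI => //; exact: measurable_cylinder.
have sub t : E (rcons v t) `<=` E v by move=> r [/cylinder_rcons[]].
apply/eqP; rewrite eq_le; apply/andP; split.
  rewrite -(@esum_finite_support _ _ (fun t => word_measure s0 k (E (rcons v t))))//.
  - rewrite -(@esum_image _ _ _ setT (rcons v)
      (fun c => word_measure s0 k (E c))); last first.
      by move=> x y _ _ /rcons_inj[].
    apply: le_trans (@outer_bigcup R S s0 k _ E); apply: le_outer => r [vr Fr].
    exists (rcons v (r (size v))); first by exists (r (size v)).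
    by split=> //; apply/cylinder_rcons.
  - move=> t tl; apply/eqP; rewrite eq_le measure_ge0 andbT.
    apply: le_trans (_ : word_measure s0 k (cylinder (rcons v t)) <= _)%E.
      by apply: le_outer => r [].
    by rewrite word_measureE weight_rcons kl// mulr0.
have -> : (\sum_(t <- l) word_measure s0 k (E (rcons v t)) =
    word_measure s0 k (\bigcup_(t in [set` l]) E (rcons v t)))%E.
  rewrite measure_fin_bigcup; first exact: fsbig_seq.
  - exact: finite_seq.
  - by move=> x y _ _ [r [[/cylinder_rcons[_ <-] _] [/cylinder_rcons[_ <-] _]]].
  - by move=> t _; exact: mE.
by apply: le_outer => r [t _ /sub].
Qed.

Lemma quiet_split (s0 : S) (k : seq S -> distr R S) v (l : seq S) n :
  uniq l -> (forall t, t \notin l -> k v t = 0) ->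
  (word_measure s0 k (cylinder v `&` quiet (size v) n.+1) =
   \sum_(t <- l) if t \in T then 0 else
     word_measure s0 k (cylinder (rcons v t) `&` quiet (size (rcons v t)) n))%E.
Proof.
move=> ul kl; rewrite (cylinder_split ul kl); last exact: measurable_quiet.
apply: eq_bigr => t _; rewrite cylinder_quietS; by case: ifP.
Qed.

Lemma buchi_quiet r : ~ buchi T r ->
  exists v s, cylinder (rcons v s) r /\ forall n, quiet (size (rcons v s)) n r.
Proof.
move=> /existsNP[i ri]; exists (mkseq r i), (r i); split.
  by apply/cylinder_rcons; rewrite /cylinder/= size_mkseq.
move=> n j; rewrite size_rcons size_mkseq => /andP[ij _] Tj.
by apply: ri; exists j => //; exact: ltnW.
Qed.

Lemma quiet_not_buchi i : \bigcap_n quiet i n `<=` ~` buchi T.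
Proof.
move=> r qr /(_ i)[j ij Tj]; apply: (qr (j - i).+1 I j) => //.
by rewrite ij addnS subnKC// ltnS leqnn.
Qed.

End quiet_runs.

Lemma distr_mean_ge (R : realType) (S : countType) (d : distr R S) (l : seq S)
    (h : S -> R) x : (forall t, 0 <= h t) -> uniq l -> x \in l -> d x = 1 ->
  h x <= \sum_(t <- l) d t * h t.
Proof.
move=> h0 ul xl dx; rewrite (bigD1_seq x)//= dx mul1r lerDl.
by apply: sumr_ge0 => t _; rewrite mulr_ge0// mass_ge0.
Qed.

(** * Probabilities of plays compared with values *)

Section play_values.
Context (R : realType) (S : countType) (G : game R S) (T : set S).
Context (hG : finitely_branching G) (L : set S).
Context (sigma : strategy G Box) (pi : strategy G Diamond) (s0 : S).

Local Notation law := (tau_word sigma pi s0).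
Local Notation mu := (word_measure s0 law).

Lemma tau_word_rcons w s : law (rcons w s) = tau sigma pi w s.
Proof. by case: w => //= x w; rewrite belast_rcons last_rcons. Qed.

Lemma tau_succ w s t : t \notin succ hG s -> tau sigma pi w s t = 0.
Proof.
rewrite mem_succ /tau; have [st|nst] := pselect (edge G s t).
  rewrite asboolT//=; case: (owner G s) => [[]|]//=.
  by rewrite lt_neqAle mass_ge0 andbT negbK => /eqP.
move=> _; case Es: (owner G s) => [[]|].
- exact: act_supported nst.
- exact: act_supported nst.
- exact: rand_supported nst.
Qed.

Lemma tau_sum1 w s : \sum_(t <- succ hG s) tau sigma pi w s t = 1.
Proof. by apply: distr_sum1; [exact: succ_uniq|exact: tau_succ]. Qed.

Lemma tau_concentrated w s x t : tau sigma pi w s x = 1 ->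
  0 < tau sigma pi w s t -> t = x.
Proof.
move=> x1 t0; apply/eqP; apply: contraT => tx.
have inl y : 0 < tau sigma pi w s y -> y \in succ hG s.
  by apply: contraTT => /tau_succ ->; rewrite ltxx.
have := tau_sum1 w s; rewrite (bigD1_seq x) ?succ_uniq ?inl ?x1//=.
rewrite -big_filter (bigD1_seq t) ?filter_uniq ?succ_uniq ?mem_filter ?tx ?inl//=.
have : 0 <= \sum_(i <- [seq i <- succ hG s | i != x] | i != t) tau sigma pi w s i.
  by apply: sumr_ge0 => u _; exact: mass_ge0.
lra.
Qed.

Lemma weight_rcons2 w s t : weight s0 law (rcons (rcons w s) t) =
  weight s0 law (rcons w s) * tau sigma pi w s t.
Proof. by rewrite weight_rcons tau_word_rcons. Qed.

Lemma weight_nneg v : 0 <= weight s0 law v.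
Proof. by rewrite -lee_fin weight_ge0. Qed.

Lemma mu_cylinder_le v E : (mu (cylinder v `&` E) <= (weight s0 law v)%:E)%E.
Proof. by rewrite -word_measureE; apply: le_outer => r []. Qed.

Lemma quiet_tau_split w s n :
  (mu (cylinder (rcons w s) `&` quiet T (size (rcons w s)) n.+1) =
   \sum_(t <- succ hG s) if t \in T then 0 else
     mu (cylinder (rcons (rcons w s) t) `&`
         quiet T (size (rcons (rcons w s) t)) n))%E.
Proof.
apply: quiet_split; first exact: succ_uniq.
by move=> t; rewrite tau_word_rcons; exact: tau_succ.
Qed.

Lemma weighted_mean w s (h : S -> R) :
  \sum_(t <- succ hG s) weight s0 law (rcons (rcons w s) t) * (1 - h t) =
  weight s0 law (rcons w s) * (1 - \sum_(t <- succ hG s) tau sigma pi w s t * h t).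
Proof.
rewrite -(tau_sum1 w s) -sumrB mulr_sumr; apply: eq_bigr => t _.
by rewrite (tau_sum1 w s) weight_rcons2; ring.
Qed.

Lemma bellman_le_mean (f : S -> S) h w s : unit_valued h ->
  (forall s, f s \in succ hG s) ->
  (forall w s, owner G s = Some Box -> sigma w s (f s) = 1) ->
  bellman T hG L (fun s => Some (f s)) h s <=
  \sum_(t <- succ hG s) tau sigma pi w s t * arrive T L h t.
Proof.
move=> h01 fs sf; have a01 t := arrive_unit T L t h01.
rewrite /bellman; case Es: (owner G s) => [[]|].
- rewrite /options Es big_seq_cond; apply: bigmax_le.
    apply: sumr_ge0 => t _; have /andP[? _] := a01 t.
    by rewrite mulr_ge0// mass_ge0.
  move=> t; rewrite inE andbT => /eqP ->; apply: distr_mean_ge => //.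
  + by move=> u; have /andP[] := a01 u.
  + exact: succ_uniq.
  + by rewrite /tau Es sf.
- rewrite -[leLHS]mul1r -(tau_sum1 w s) mulr_suml big_seq [leRHS]big_seq.
  apply: ler_sum => t ts.
  by rewrite ler_wpM2l ?mass_ge0//; exact: ge_bigmin_seq.
- by rewrite /tau Es.
Qed.

(** Box may randomise and may even enter [L]: an average is at most the maximum, and arrivals in
    [L], which are missing from the options, count 0. *)
Lemma mean_le_bellman h w s : unit_valued h ->
  (owner G s = Some Diamond -> exists t, [/\ t \in succ hG s,
     arrive T L h t <= bellman T hG L (@no_choice S) h s & pi w s t = 1]) ->
  \sum_(t <- succ hG s) tau sigma pi w s t * arrive T L h t <=
  bellman T hG L (@no_choice S) h s.
Proof.
move=> h01 piP; have a01 t := arrive_unit T L t h01.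
case Es: (owner G s) => [[]|].
- rewrite -[leRHS]mul1r -(tau_sum1 w s) mulr_suml big_seq [leRHS]big_seq.
  apply: ler_sum => t ts; rewrite ler_wpM2l ?mass_ge0//.
  have [tL|tL] := boolP (t \in L).
    by rewrite /arrive tL; have /andP[] := bellman_unit T hG L (@no_choice S) h01 s.
  rewrite /bellman Es; apply: le_bigmax_seq => //.
  by rewrite /options Es mem_filter tL.
- have [t [ts ht pt]] := piP Es; apply: le_trans ht.
  (* Passing to complements turns the lower bound on a mean into the upper bound needed here. *)
  have : 1 - arrive T L h t <=
      \sum_(u <- succ hG s) tau sigma pi w s u * (1 - arrive T L h u).
    apply: (distr_mean_ge (h := fun u => 1 - arrive T L h u)) => //.
    + by move=> u; rewrite subr_ge0; have /andP[] := a01 u.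
    + exact: succ_uniq.
    + by rewrite /tau Es.
  under eq_bigr do rewrite mulrBr mulr1.
  by rewrite sumrB tau_sum1; lra.
- by rewrite /bellman /tau Es.
Qed.

Lemma box_quiet_le (f : S -> S) n w s :
  (forall s, f s \in succ hG s) ->
  (forall w s, owner G s = Some Box -> sigma w s (f s) = 1) ->
  (mu (cylinder (rcons w s) `&` quiet T (size (rcons w s)) n) <=
   (weight s0 law (rcons w s) *
    (1 - value T hG L (fun s => Some (f s)) n s))%:E)%E.
Proof.
move=> fs sf; elim: n w s => [|n ih] w s.
  by rewrite subr0 mulr1; exact: mu_cylinder_le.
have v01 := value_unit T hG L (fun s => Some (f s)) n.
rewrite quiet_tau_split; apply: (@le_trans _ _ (\sum_(t <- succ hG s)
    (weight s0 law (rcons (rcons w s) t) *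
     (1 - arrive T L (value T hG L (fun s => Some (f s)) n) t))%:E)%E).
  apply: lee_sum => t _; case: ifP => tT.
    rewrite lee_fin mulr_ge0 ?weight_nneg// subr_ge0.
    by have /andP[] := arrive_unit T L t v01.
  rewrite /arrive tT; case: ifP => tL; last exact: ih.
  by rewrite subr0 mulr1; exact: mu_cylinder_le.
rewrite sumEFin weighted_mean lee_fin ler_wpM2l ?weight_nneg// lerD2l lerN2.
exact: bellman_le_mean.
Qed.

(** Since [full] speaks only about states outside [L], histories of positive probability have to
    stay there. *)
Lemma box_path_avoid (f : S -> S) w s : ~ L s0 ->
  viable hG L (fun s => Some (f s)) ->
  (forall w s, owner G s = Some Box -> sigma w s (f s) = 1) ->
  0 < weight s0 law (rcons w s) -> ~ L s.
Proof.
move=> Ls0 vf sf; elim/last_ind: w s => [|w s ih] t.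
  rewrite weight_rcons weight_nil mul1r /=; case: eqVneq => [->//|_].
  by rewrite ltxx.
rewrite weight_rcons2 => wt0; have ws0 := weight_nneg (rcons w s).
have tp := mass_ge0 (tau sigma pi w s) t.
have wp : 0 < weight s0 law (rcons w s) by nra.
have tp' : 0 < tau sigma pi w s t by nra.
have ts : t \in succ hG s by apply: contraTT tp' => /tau_succ ->; rewrite ltxx.
have [_] := vf s (ih _ wp); apply; rewrite /options.
case Es: (owner G s) => [[]|]//; rewrite inE; apply/eqP.
by apply: (@tau_concentrated w s) => //; rewrite /tau Es sf.
Qed.

(** A run outside the objective is quiet forever after some finite history. There are countably many
    histories, and each contributes probability 0, because the value at its last state is 1 in the
    limit. *)
Lemma box_buchi (f : S -> S) : ~ L s0 ->
  (forall s, f s \in succ hG s) ->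
  viable hG L (fun s => Some (f s)) -> full T hG L (fun s => Some (f s)) ->
  (forall w s, owner G s = Some Box -> sigma w s (f s) = 1) ->
  mu (~` buchi T) = 0%E.
Proof.
move=> Ls0 fs vf ff sf; apply/eqP; rewrite eq_le measure_ge0 andbT.
pose E v : set (nat -> S) := if v is [::] then set0
  else cylinder v `&` \bigcap_n quiet T (size v) n.
apply: (@le_trans _ _ (\esum_(v in [set: seq S]) mu (E v))%E); last first.
  rewrite esum1// => v _; case/lastP: v => [|w s]; first exact: outer0.
  have -> : E (rcons w s) = cylinder (rcons w s) `&`
      \bigcap_n quiet T (size (rcons w s)) n by case: w.
  apply/eqP; rewrite eq_le measure_ge0 andbT.
  have [wp|] := ltP 0 (weight s0 law (rcons w s)); last first.
    by rewrite -lee_fin; apply: le_trans; exact: mu_cylinder_le.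
  apply/lee_addgt0Pr => e e0; rewrite add0e.
  have ew : 0 < e / weight s0 law (rcons w s) by rewrite divr_gt0.
  have [n nv] := ff _ ew s (box_path_avoid Ls0 vf sf wp).
  apply: (@le_trans _ _ (mu (cylinder (rcons w s) `&` quiet T (size (rcons w s)) n))).
    by apply: le_outer => r [cr qr]; split => //; exact: qr.
  apply: le_trans (box_quiet_le n w s fs sf) _; rewrite lee_fin.
  have -> : e = weight s0 law (rcons w s) * (e / weight s0 law (rcons w s)).
    by rewrite mulrC divfK// gt_eqF.
  by rewrite ler_wpM2l ?weight_nneg//; lra.
apply: le_trans (@outer_bigcup R S s0 law _ E); apply: le_outer => r /buchi_quiet.
move=> [w [s [cr qr]]]; exists (rcons w s) => //.
have -> : E (rcons w s) = cylinder (rcons w s) `&`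
    \bigcap_n quiet T (size (rcons w s)) n by case: (w).
by split => // n _; exact: qr.
Qed.

Local Notation lv := (limit_value T hG L).

(** Minimising moves do not let [lv] increase on average, so [1 - lv] bounds the chance of staying
    quiet for every horizon. Where [lv] is 1 the bound is 0, so nothing is asked of Diamond
    there. *)
Lemma diamond_quiet_ge v0 :
  (forall w s, prefix v0 (rcons w s) -> 0 < weight s0 law (rcons w s) ->
     ~ L s /\ (lv s < 1 -> owner G s = Some Diamond ->
       exists t, [/\ t \in succ hG s,
         arrive T L lv t <= bellman T hG L (@no_choice S) lv s & pi w s t = 1])) ->
  forall n w s, prefix v0 (rcons w s) ->
  ((weight s0 law (rcons w s) * (1 - lv s))%:E <=
   mu (cylinder (rcons w s) `&` quiet T (size (rcons w s)) n))%E.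
Proof.
move=> hyp; have l01 := limit_value_unit T hG L.
elim=> [|n ih] w s pws.
  rewrite quiet0 setIT word_measureE lee_fin ler_piMr ?weight_nneg//.
  by rewrite lerBlDr lerDl; have /andP[] := l01 s.
have [wp|w0] := ltP 0 (weight s0 law (rcons w s)); last first.
  apply: le_trans (measure_ge0 _ _); rewrite lee_fin mulr_le0_ge0// subr_ge0.
  by have /andP[] := l01 s.
have [ls1|ls1] := ltP (lv s) 1; last first.
  apply: le_trans (measure_ge0 _ _); rewrite lee_fin mulr_ge0_le0//.
    exact: weight_nneg.
  by rewrite subr_le0.
have [_ /(_ ls1) piP] := hyp _ _ pws wp.
rewrite quiet_tau_split; apply: (@le_trans _ _ (\sum_(t <- succ hG s)
    (weight s0 law (rcons (rcons w s) t) * (1 - arrive T L lv t))%:E)%E).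
  rewrite sumEFin weighted_mean lee_fin ler_wpM2l ?weight_nneg// lerD2l lerN2.
  by apply: le_trans (bellman_limit_le T hG L s); exact: mean_le_bellman.
apply: lee_sum => t _.
have pt : prefix v0 (rcons (rcons w s) t).
  by move/prefixP : pws => [x ->]; rewrite rcons_cat prefix_prefix.
have [wt|wt] := ltP 0 (weight s0 law (rcons (rcons w s) t)); last first.
  have -> : weight s0 law (rcons (rcons w s) t) = 0.
    by apply/eqP; rewrite eq_le wt weight_nneg.
  by rewrite mul0r; case: ifP => _ //; exact: measure_ge0.
have [Lt _] := hyp _ _ pt wt; rewrite /arrive not_L_in//.
by case: ifP => _; [rewrite subrr mulr0|exact: ih].
Qed.

(** The bound for quiet windows does not depend on [n]; continuity from above carries it to runs
    that are quiet forever. *)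
Lemma diamond_not_buchi w s : 0 < weight s0 law (rcons w s) -> lv s < 1 ->
  (forall w' s', prefix (rcons w s) (rcons w' s') ->
     0 < weight s0 law (rcons w' s') ->
     ~ L s' /\ (lv s' < 1 -> owner G s' = Some Diamond ->
       exists t, [/\ t \in succ hG s',
         arrive T L lv t <= bellman T hG L (@no_choice S) lv s' & pi w' s' t = 1])) ->
  mu (cylinder (rcons w s) `&` ~` buchi T) <> 0%E.
Proof.
move=> wp ls1 hyp mu0.
have ge n := diamond_quiet_ge hyp n (prefix_refl _).
pose F n : set (runs s0) := cylinder (rcons w s) `&` quiet T (size (rcons w s)) n.
have mF n : measurable (F n).
  by apply: measurableI; [exact: measurable_cylinder|exact: measurable_quiet].
have cF : (mu \o F) x @[x --> \oo] --> mu (\bigcap_n F n).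
  apply: nonincreasing_cvg_mu => //.
  - by rewrite (le_lt_trans (mu_cylinder_le _ _))// ltry.
  - exact: bigcapT_measurable.
  - move=> m n mn; apply/subsetPset => r [cr qr]; split=> // j /andP[ij jm].
    by apply: qr; rewrite ij (leq_trans jm)// leq_add2l.
have : ((weight s0 law (rcons w s) * (1 - lv s))%:E <= mu (\bigcap_n F n))%E.
  rewrite -(cvg_lim _ cF)//; apply: lime_ge.
    by apply/cvg_ex; exists (mu (\bigcap_n F n)).
  by apply: nearW => n; exact: ge.
have : (mu (\bigcap_n F n) <= mu (cylinder (rcons w s) `&` ~` buchi T))%E.
  apply: le_outer => r Fr; split; first by have [] := Fr 0%N I.
  by apply: (@quiet_not_buchi _ T (size (rcons w s))) => n nI; have [] := Fr n nI.
rewrite mu0 => h1 h2; have := le_trans h2 h1; rewrite lee_fin leNgt => /negP; apply.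
by rewrite mulr_gt0// subr_gt0.
Qed.

End play_values.

(** * Maximal spoiling strategies of Diamond *)

Section spoiling.
Context (R : realType) (S : countType) (G : game R S) (T : set S).
Context (hG : finitely_branching G).

(* [M] is the graph of a partial memoryless Diamond strategy that spoils the
   objective on its domain.  Quantifying over histories, rather than starting
   at a state of the domain, makes it unnecessary to shift strategies. *)
Definition spoils (M : set (S * S)) :=
  [/\ forall s t t', M (s, t) -> M (s, t') -> t = t',
      forall s t, M (s, t) -> edge G s t &
      forall (sigma : strategy G Box) (pi : strategy G Diamond) s0 w s t,
        (forall s t, M (s, t) -> owner G s = Some Diamond ->
           forall w, pi w s t = 1) ->
        M (s, t) -> 0 < weight s0 (tau_word sigma pi s0) (rcons w s) ->
        word_measure s0 (tau_word sigma pi s0)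
          (cylinder (rcons w s) `&` ~` buchi T) <> 0%E].

(** The domain may contain states of any owner; at Box and random states the successor recorded in
    [M] is only a marker. *)
Definition spoiled (M : set (S * S)) : set S := [set s | exists t, M (s, t)].

Lemma spoils_maximal_full M : spoils M -> (forall N, M `<` N -> ~ spoils N) ->
  full T hG (spoiled M) (@no_choice S).
Proof.
move=> [Mfun Medge Mspoil] Mmax; pose lv := limit_value T hG (spoiled M).
apply: limit_value_full => s1 Ls1; rewrite leNgt; apply/negP => lv1.
have [g gP] : {g : S -> S & forall s, g s \in succ hG s /\
    (owner G s = Some Diamond ->
     arrive T (spoiled M) lv (g s) <= bellman T hG (spoiled M) (@no_choice S) lv s)}.
  apply: (@choice _ _ (fun s y => y \in succ hG s /\ (owner G s = Some Diamond ->
    arrive T (spoiled M) lv y <= bellman T hG (spoiled M) (@no_choice S) lv s))) => s.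
  have [Es|nE] := pselect (owner G s = Some Diamond).
    have [t ts ht] := diamond_minimizer T hG (spoiled M) (@no_choice S)
      (limit_value_unit T hG (spoiled M)) Es.
    by exists t.
  by case E : (succ hG s) (succ_neq0 hG s) => [//|y l] _; exists y; rewrite mem_head.
pose N := M `|` [set x | [/\ ~ spoiled M x.1, lv x.1 < 1 & x.2 = g x.1]].
apply: (Mmax N).
  split; first exact: subsetUl.
  by move=> /(_ (s1, g s1))/= h; apply: (Ls1); exists (g s1); apply: h; right; split.
split.
- move=> s t t' [Mst|[/= Ls _ ->]] [Mst'|[/= Ls' _ ->]] //; first exact: Mfun Mst Mst'.
    by case: Ls'; exists t.
  by case: Ls; exists t'.
- move=> s t [/Medge//|[/= _ _ ->]]; exact: succ_edge (gP s).1.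
move=> sigma pi s0 w s t Npi [Mst|[/= Ls ls1 _]] wp.
  by apply: (Mspoil sigma pi s0 w s t) => // x y Mxy; apply: Npi; left.
(* Assuming that the failure after [w] is null, no continuation of positive probability can meet
   [spoiled M], where [M] would already make failure possible. So [L] is avoided as
   [diamond_not_buchi] demands. *)
move=> mu0; apply: (diamond_not_buchi wp ls1 _ mu0) => w' s' pw w'p.
have Ls' : ~ spoiled M s'.
  move=> [t' Mst']; apply: (Mspoil sigma pi s0 w' s' t') => //.
    by move=> x y Mxy; apply: Npi; left.
  apply/eqP; rewrite eq_le measure_ge0 andbT -mu0; apply: le_outer => r [cr Br].
  by split => //; exact: cylinder_prefix pw _ cr.
split=> // ls' Es'; exists (g s'); split; first by have [] := gP s'.
  by have [_ ->] := gP s'.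
by apply: Npi => //; right.
Qed.

(** Zorn's lemma applies: a strategy that follows the union of a chain follows each member, and
    every state of the union's domain is spoiled by one member. *)
Lemma exists_spoils_maximal :
  exists M, spoils M /\ forall N, M `<` N -> ~ spoils N.
Proof.
apply: Zorn_bigcup => F Fs Ftot; split.
- move=> s t t' [X FX Xst] [Y FY Yst'].
  have [XY|YX] := Ftot X Y FX FY.
    by have [Yfun _ _] := Fs Y FY; exact: Yfun (XY _ Xst) Yst'.
  by have [Xfun _ _] := Fs X FX; exact: Xfun Xst (YX _ Yst').
- by move=> s t [X FX Xst]; have [_ Xedge _] := Fs X FX; exact: Xedge.
- move=> sigma pi s0 w s t Fpi [X FX Xst]; have [_ _ Xspoil] := Fs X FX.
  by apply: Xspoil Xst => x y Xxy; apply: Fpi; exists X.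
Qed.

(** * Memoryless strategies and the conclusion *)

Lemma memoryless_supported p (f : S -> S) : (forall s, edge G s (f s)) ->
  forall (w : seq S) s, owner G s = Some p ->
  supported (dirac_distr R (f s)) (edge G s).
Proof.
by move=> fe w s _ t st; rewrite /=; case: eqVneq => // ts; rewrite ts in st.
Qed.

Definition memoryless p (f : S -> S) (fe : forall s, edge G s (f s)) :
  strategy G p := Strategy (memoryless_supported (p := p) fe).

Lemma memoryless_act p f fe w s : @memoryless p f fe w s (f s) = 1.
Proof. by rewrite /= eqxx. Qed.

Lemma memoryless_MD p f fe : is_MD (@memoryless p f fe).
Proof. by exists f => w s _; exact: memoryless_act. Qed.

End spoiling.

Theorem theorem11 (R : realType) (S : countType) (G : game R S) (T : set S)
    (hG : finitely_branching G) :
  (exists (sigma_hat : strategy G Box) (pi_hat : strategy G Diamond),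
    [/\ is_MD sigma_hat, is_MD pi_hat &
      forall s : S,
        (forall pi : strategy G Diamond,
           prob sigma_hat pi s (buchi T) = 1%E) \/
        (forall sigma : strategy G Box,
           (prob sigma pi_hat s (buchi T) < 1)%E)]) /\
  almost_surely_strongly_MD_determined G (buchi T).
Proof.
suff main : exists (sigma_hat : strategy G Box) (pi_hat : strategy G Diamond),
    [/\ is_MD sigma_hat, is_MD pi_hat &
      forall s : S,
        (forall pi : strategy G Diamond,
           prob sigma_hat pi s (buchi T) = 1%E) \/
        (forall sigma : strategy G Box,
           (prob sigma pi_hat s (buchi T) < 1)%E)].
  split=> // s; have [sigma [pi [sMD pMD /(_ s)[h|h]]]] := main.
    by left; exists sigma.
  by right; exists pi.
have [M [Ms Mmax]] := exists_spoils_maximal G T.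
have [Mfun Medge Mspoil] := Ms.
have [f [fs vf ff]] := memoryless_choice (spoils_maximal_full hG Ms Mmax).
have fe s : edge G s (f s) by apply: succ_edge (fs s).
have [g gP] : {g : S -> S & forall s, edge G s (g s) /\
    forall t, M (s, t) -> g s = t}.
  (* Diamond follows [M] on its domain and any edge elsewhere. *)
  apply: (@choice _ _ (fun s y => edge G s y /\ forall t, M (s, t) -> y = t)) => s.
  have [[t st]|nM] := pselect (spoiled M s).
    by exists t; split=> [|t']; [exact: Medge|exact: Mfun].
  by have [t st] := edge_total G s; exists t; split => // t' st'; case: nM; exists t'.
have ge s := (gP s).1.
exists (memoryless Box fe), (memoryless Diamond ge).
split; [exact: memoryless_MD|exact: memoryless_MD|] => s.
have mB := @measurable_buchi S s T.
have [[t st]|Ls] := pselect (spoiled M s); [right=> sigma|left=> pi].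
  rewrite ltNge; apply/negP => B1.
  set P := play_law sigma (memoryless Diamond ge) s.
  have PB : P (~` buchi T) = 0%E.
    rewrite probability_setC//; have -> : P (buchi T) = 1%E.
      by apply/eqP; rewrite eq_le B1 andbT; exact: probability_le1.
    by rewrite subee.
  (* The history consisting of [s] alone has weight 1, so spoiling after it contradicts that the
     complement of the objective is null. *)
  apply: (Mspoil sigma (memoryless Diamond ge) s [::] s t) => //.
  - by move=> x y /(gP x).2 <- _ w; exact: memoryless_act.
  - by rewrite weight_rcons weight_nil mul1r /= eqxx ltr01.
  - apply/eqP; rewrite eq_le measure_ge0 andbT -PB.
    by apply: le_outer => r [].
set P := play_law (memoryless Box fe) pi s.
change (P (buchi T) = 1%E); rewrite -[buchi T]setCK probability_setC; last first.
  exact: measurableC.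
have -> : P (~` buchi T) = 0%E.
  change (word_measure s (tau_word (memoryless Box fe) pi s) (~` buchi T) = 0%E).
  apply: (@box_buchi _ _ _ _ _ _ (memoryless Box fe) pi _ _ Ls fs vf ff) => w x _.
  exact: memoryless_act.
by rewrite sube0.
Qed.
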